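(* Let $d\ge 1$ and $\sigma\in\mathbb N$ with $\sigma\ge d+1$. Let $g=\begin{pmatrix} a&\mathbf b^t\\ \mathbf c& D\end{pmatrix}\in \mathrm{SU}(1,d)$ with $a,b_i,c_i\neq 0$ for $i=1,\ldots,d$. Then for all $\mathbf m,\mathbf n\in\mathbb N_0^d$ $$\pi^\sigma_{\mathbf m,\mathbf n}(g)=\sqrt{\frac{(\sigma)_{|\mathbf m|}(\sigma)_{|\mathbf n|}}{\mathbf m!\,\mathbf n!}}\,(-1)^{|\mathbf m|}a^{-\sigma}\,\tilde{\mathbf p}^{\mathbf m}\,\mathbf p^{\mathbf n}\,M_{\mathbf m}(\mathbf n;U,\sigma),$$ where $\mathbf p=(p_1,\ldots,p_d)$, $\tilde{\mathbf p}=(\tilde p_1,\ldots,\tilde p_d)$ and $U=(U_{i,j})_{i,j=1}^d$ are given by $$p_i=\frac{b_i}{a},\qquad \tilde p_i=\frac{c_i}{a},\qquad U_{i,j}=\frac{aD_{j,i}}{b_ic_j}.$$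
   Context: Notation: $\mathbb N_0=\{0,1,2,\dots\}$. For $\mathbf x\in\mathbb C^d$: $|\mathbf x|=x_1+\cdots+x_d$ (plain sum), $\|\mathbf x\|=\sqrt{|x_1|^2+\cdots+|x_d|^2}$. For $\mathbf n\in\mathbb N_0^d$: $\mathbf n!=n_1!\cdots n_d!$, $\mathbf x^{\mathbf n}=x_1^{n_1}\cdots x_d^{n_d}$. $(\beta)_n=\beta(\beta+1)\cdots(\beta+n-1)$. Group: $J=\mathrm{diag}(1,-1,\ldots,-1)$ of size $d+1$; $\mathrm{SU}(1,d)=\{g\in \mathrm{SL}(d+1,\mathbb C): g^\dagger Jg=J\}$, where $\dagger$ is conjugate transpose. Elements are written in block form $g=\begin{pmatrix} a&\mathbf b^t\\ \mathbf c& D\end{pmatrix}$ with $a\in\mathbb C$, $\mathbf b,\mathbf c\in\mathbb C^d$ (column vectors), $D$ a complex $d\times d$ matrix. Representation: let $\alpha=\sigma-d-1\in\mathbb N_0$, let $\mathbb B_d=\{\mathbf z\in\mathbb C^d:\|\mathbf z\|<1\}$, and $dv_\alpha=c_\alpha(1-\|\mathbf z\|^2)^\alpha dv$, with $dv$ the volume (Lebesgue) measure and $c_\alpha$ chosen so that $v_\alpha(\mathbb B_d)=1$. The Bergman space $\mathcal A_\alpha$ is the Hilbert space of holomorphic functions in $L^2(\mathbb B_d,dv_\alpha)$, with inner product $\langle f,h\rangle=\int_{\mathbb B_d}f\,\overline h\,dv_\alpha$ and orthonormal basis $e_{\mathbf m}(\mathbf z)=\sqrt{(\sigma)_{|\mathbf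 m|}/\mathbf m!}\;\mathbf z^{\mathbf m}$, $\mathbf m\in\mathbb N_0^d$. The unitary representation $\pi^\sigma$ of $\mathrm{SU}(1,d)$ on $\mathcal A_\alpha$ is $$[\pi^\sigma(g)f](\mathbf z)=(a+\mathbf c^t\mathbf z)^{-\sigma}f\!\left(\frac{\mathbf b+D^t\mathbf z}{a+\mathbf c^t\mathbf z}\right).$$ Its matrix coefficients are $\pi^\sigma_{\mathbf m,\mathbf n}(g)=\langle\pi^\sigma(g)e_{\mathbf n},e_{\mathbf m}\rangle$, i.e. $\pi^\sigma(g)e_{\mathbf n}=\sum_{\mathbf m}\pi^\sigma_{\mathbf m,\mathbf n}(g)e_{\mathbf m}$. Multivariate Meixner polynomials: for $\beta\in\mathbb C\setminus(-\mathbb N_0)$ and a complex $d\times d$ matrix $U=(U_{i,j})$, $M_{\mathbf n}(\mathbf x;U,\beta)$ ($\mathbf n\in\mathbb N_0^d$, $\mathbf x\in\mathbb C^d$) is defined by $$\Big(1-\sum_{j=1}^dt_j\Big)^{-\beta-|\mathbf x|}\prod_{i=1}^d\Big(1-\sum_{j=1}^dU_{i,j}t_j\Big)^{x_i}=\sum_{\mathbf n\in\mathbb N_0^d}\frac{(\beta)_{|\mathbf n|}}{\mathbf n!}M_{\mathbf n}(\mathbf x;U,\beta)\,\mathbf t^{\mathbf n}$$ for $\mathbf t\in\mathbb C^d$ sufficiently close to $0$ (principal branches of powers). *)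

(* Defs.v *)
From HB Require Import structures.
From mathcomp Require Import all_boot all_order all_algebra finmap.
From mathcomp Require Import all_classical all_reals all_analysis.
From mathcomp Require Import complex.

Set Implicit Arguments.
Unset Strict Implicit.
Unset Printing Implicit Defensive.

Import Order.TTheory GRing.Theory Num.Theory.
Import Normc.
Import complex.

Local Open Scope classical_set_scope.
Local Open Scope ring_scope.
Local Open Scope complex_scope.
Local Open Scope sesquilinear_scope.

Section multi_index.
Context {d : nat}.

Definition mnat := {ffun 'I_d -> nat}.

Definition mdegree (n : mnat) : nat := (\sum_(i < d) n i)%N.

Definition mfactorial (n : mnat) : nat := (\prod_(i < d) (n i)`!)%N.

Definition mpower {C : comNzRingType} (x : 'cV[C]_d) (n : mnat) : C :=
  \prod_(i < d) x i 0 ^+ n i.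

Definition mvector {C : nzRingType} (n : mnat) : 'cV[C]_d :=
  \col_i (n i)%:R.

End multi_index.
Arguments mnat : clear implicits.

Definition pochhammer {C : nzRingType} (b : C) (n : nat) : C :=
  \prod_(k < n) (b + k%:R).

Section complex_power.
Context {R : realType}.

Definition cexp (z : R[i]) : R[i] :=
  (expR (Re z) * cos (Im z)) +i* (expR (Re z) * sin (Im z)).

(* principal argument, in ]-pi, pi] *)
Definition carg (z : R[i]) : R :=
  if 0 <= Im z then acos (Re z / normc z) else - acos (Re z / normc z).

Definition clog (z : R[i]) : R[i] := ln (normc z) +i* carg z.

(* Principal branch of z ^ w; only meaningful for z != 0. *)
Definition cpow (z w : R[i]) : R[i] := cexp (w * clog z).

End complex_power.

Section euclidean_norm.
Context {R : realType} {d : nat}.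

Definition hnorm (z : 'cV[R[i]]_d) : R :=
  Num.sqrt (\sum_(i < d) normc (z i 0) ^+ 2).

Definition vsum (x : 'cV[R[i]]_d) : R[i] := \sum_(i < d) x i 0.

End euclidean_norm.

(* Unconditional summation: convergence of the net of finite partial sums. *)
Definition has_sum {R : realType} {I : choiceType} (u : I -> R[i]) (s : R[i]) :=
  forall e : R, 0 < e -> exists A : {fset I}, forall B : {fset I},
    (A `<=` B)%fset -> normc (\sum_(n <- enum_fset B) u n - s) < e.

Section meixner.
Context {R : realType} {d : nat}.
Implicit Types (x t : 'cV[R[i]]_d) (U : 'M[R[i]]_d) (beta : R[i]).

Definition meixner_gen x U beta t : R[i] :=
  cpow (1 - \sum_(j < d) t j 0) (- beta - vsum x) *
  \prod_(i < d) cpow (1 - \sum_(j < d) U i j * t j 0) (x i 0).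

Definition meixner_expansion x U beta (M : mnat d -> R[i]) : Prop :=
  exists r : R, 0 < r /\ forall t, hnorm t < r ->
    has_sum (fun n : mnat d =>
      pochhammer beta (mdegree n) / (mfactorial n)%:R * M n * mpower t n)
      (meixner_gen x U beta t).

(* M_n(x; U, beta): for beta not in -N_0 the expansion above determines the
   coefficients; for beta in -N_0 the value is irrelevant. *)
Definition meixner (n : mnat d) x U beta : R[i] :=
  xget (fun=> 0) [set M | meixner_expansion x U beta M] n.

End meixner.

(* The sigma-finite instance of m1 \x m2 is not found by canonical resolution:
   it is shadowed by the one for subprobabilities. *)
Lemma product_sigma_finite d1 d2 (T1 : measurableType d1)
    (T2 : measurableType d2) (R : realType)
    (m1 : {sigma_finite_measure set T1 -> \bar R})
    (m2 : {sigma_finite_measure set T2 -> \bar R}) :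
  sigma_finite setT (m1 \x m2)%E.
Proof.
have /sigma_finiteP[F [TF ndF Foo]] := sigma_finiteT m1.
have /sigma_finiteP[G [TG ndG Goo]] := sigma_finiteT m2.
exists (fun n => F n `*` G n).
  rewrite -setXTT TF TG predeqE => -[x y]; split.
    move=> [/= [n _ Fnx] [k _ Gky]]; exists (maxn n k) => //; split.
    - by move: x Fnx; exact/subsetPset/ndF/leq_maxl.
    - by move: y Gky; exact/subsetPset/ndG/leq_maxr.
  by move=> [n _ []/= ? ?]; split; exists n.
move=> k; have [? ?] := Foo k; have [? ?] := Goo k.
split; first exact: measurableX.
by rewrite product_measure1E// lte_mul_pinfty// ge0_fin_numE.
Qed.

(* The n-fold power of a sigma-finite measure, on n-tuples. *)
Section tuple_measure.
Context {disp : measure_display} {T : measurableType disp} {R : realType}.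
Variable m : {sigma_finite_measure set T -> \bar R}.

Definition tuple_cons n (x : T * n.-tuple T) : n.+1.-tuple T :=
  [tuple of x.1 :: x.2].

Definition tuple_uncons n (t : n.+1.-tuple T) : T * n.-tuple T :=
  (tnth t ord0, [tuple of behead t]).

Lemma measurable_tuple_cons n : measurable_fun setT (@tuple_cons n).
Proof. by apply: measurable_cons. Qed.

Lemma measurable_tuple_uncons n : measurable_fun setT (@tuple_uncons n).
Proof.
apply: measurable_fun_pair.
  exact: measurable_tnth.
exact: measurable_behead.
Qed.

Lemma tuple_consK n : cancel (@tuple_cons n) (@tuple_uncons n).
Proof.
by move=> [x t]; rewrite /tuple_uncons (tnth_nth x) /=; congr pair; exact/val_inj.
Qed.

Section tuple_cons_measure.
Variables (n : nat) (mn : {sigma_finite_measure set (n.-tuple T) -> \bar R}).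

Definition tuple_cons_measure : set (n.+1.-tuple T) -> \bar R :=
  pushforward (m \x mn)%E (@tuple_cons n).

Let mu0 : tuple_cons_measure set0 = 0%E.
Proof. by rewrite /tuple_cons_measure /pushforward preimage_set0 measure0. Qed.

Let mu_ge0 A : (0 <= tuple_cons_measure A)%E.
Proof. exact: (measure_ge0 (m \x mn)%E). Qed.

Let mu_sigma_additive : semi_sigma_additive tuple_cons_measure.
Proof.
have mf := @measurable_tuple_cons n.
move=> F mF tF mUF; rewrite /tuple_cons_measure /pushforward preimage_bigcup.
apply: measure_semi_sigma_additive.
- by move=> k; rewrite -[X in measurable X]setTI; exact: mf.
- apply/trivIsetP => /= i j _ _ ij; rewrite -preimage_setI.
  by move/trivIsetP : tF => /(_ _ _ _ _ ij) ->//; rewrite preimage_set0.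
- by rewrite -preimage_bigcup -[X in measurable X]setTI; exact: mf.
Qed.

HB.instance Definition _ := isMeasure.Build _ _ _ tuple_cons_measure
  mu0 mu_ge0 mu_sigma_additive.

Let mu_sigma_finite : sigma_finite setT tuple_cons_measure.
Proof.
have [F UF Ffin] := product_sigma_finite m mn.
exists (fun k => @tuple_uncons n @^-1` F k).
  by rewrite -preimage_bigcup -UF preimage_setT.
move=> k; have [mF Foo] := Ffin k; split.
  by rewrite -[X in measurable X]setTI; exact: measurable_tuple_uncons.
rewrite /tuple_cons_measure /pushforward -comp_preimage.
by rewrite (_ : _ \o _ = id) ?preimage_id//; apply/funext => x; exact: tuple_consK.
Qed.

HB.instance Definition _ := Measure_isSigmaFinite.Build _ _ _
  tuple_cons_measure mu_sigma_finite.

End tuple_cons_measure.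

Fixpoint tuple_measure n : {sigma_finite_measure set (n.-tuple T) -> \bar R} :=
  if n is k.+1 then tuple_cons_measure (tuple_measure k)
  else \d_[tuple].

End tuple_measure.

Section volume.
Variable R : realType.

(* Points of C^d carry the measurable structure of (R * R)^d, the pair (x, y)
   standing for x + i y. *)
Definition planeR : measurableType _ :=
  (measurableTypeR R * measurableTypeR R)%type.

Definition lebesgue_plane : set planeR -> \bar R :=
  (@lebesgue_measure R \x @lebesgue_measure R)%E.

HB.instance Definition _ := Measure.on lebesgue_plane.
HB.instance Definition _ := Measure_isSigmaFinite.Build _ _ _ lebesgue_plane
  (product_sigma_finite lebesgue_measure lebesgue_measure).

Definition volume (d : nat) :
    {sigma_finite_measure set (d.-tuple planeR) -> \bar R} :=
  tuple_measure lebesgue_plane d.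

Definition cpoint {d} (p : d.-tuple planeR) : 'cV[R[i]]_d :=
  \col_i ((tnth p i).1 +i* (tnth p i).2).

Definition unit_ball d : set (d.-tuple planeR) :=
  [set p | hnorm (cpoint p) < 1].

End volume.

Section bergman.
Context {R : realType} {d : nat}.
Implicit Types (alpha sigma : nat) (f h : 'cV[R[i]]_d -> R[i]).

Definition bergman_weight alpha (z : 'cV[R[i]]_d) : R :=
  (1 - hnorm z ^+ 2) ^+ alpha.

Definition bergman_const alpha : R :=
  (\int[volume R d]_(p in @unit_ball R d) bergman_weight alpha (cpoint p))^-1.

Definition bergman_density alpha (z : 'cV[R[i]]_d) : R :=
  bergman_const alpha * bergman_weight alpha z.

Definition bergman_inner alpha f h : R[i] :=
  let F p := f (cpoint p) * (h (cpoint p))^* *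
             (bergman_density alpha (cpoint p))%:C in
  (\int[volume R d]_(p in @unit_ball R d) Re (F p)) +i*
  (\int[volume R d]_(p in @unit_ball R d) Im (F p)).

Definition bergman_basis sigma (n : mnat d) (z : 'cV[R[i]]_d) : R[i] :=
  (Num.sqrt (pochhammer sigma%:R (mdegree n) / (mfactorial n)%:R))%:C *
  mpower z n.

End bergman.

Section representation.
Context {R : realType} {d : nat}.
Implicit Types g : 'M[R[i]]_(1 + d).

Definition signature_mx : 'M[R[i]]_(1 + d) := block_mx 1%:M 0 0 (- 1%:M).

Definition SU1 : set 'M[R[i]]_(1 + d) :=
  [set g | \det g = 1 /\ g^t* *m signature_mx *m g = signature_mx].

Definition bergman_rep (sigma : nat) g (f : 'cV[R[i]]_d -> R[i])
    (z : 'cV[R[i]]_d) : R[i] :=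
  let a := ulsubmx g 0 0 in
  let b := (ursubmx g)^T in
  let c := dlsubmx g in
  let D := drsubmx g in
  let q := a + (c^T *m z) 0 0 in
  q ^- sigma * f (q^-1 *: (b + D^T *m z)).

(* The Bergman parameter is alpha = sigma - d - 1; nat subtraction is harmless
   under d + 1 <= sigma. *)
Definition matrix_coeff (sigma : nat) (m n : mnat d) g : R[i] :=
  bergman_inner (sigma - d.+1) (bergman_rep sigma g (bergman_basis sigma n))
    (bergman_basis sigma m).

End representation.

(* Main.v *)
Require Import Defs.
From HB Require Import structures.
From mathcomp Require Import all_boot all_order all_algebra finmap.
From mathcomp Require Import all_classical all_reals all_analysis.
From mathcomp Require Import measurable_realfun.
From mathcomp Require Import complex ring lra zify.

Set Implicit Arguments.
Unset Strict Implicit.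
Unset Printing Implicit Defensive.

Import Order.TTheory GRing.Theory Num.Theory.
Import numFieldNormedType.Exports.
Import Normc.
Import complex.
Local Open Scope classical_set_scope.
Local Open Scope ring_scope.

Local Open Scope complex_scope.
(** Write the Bergman-space matrix coefficient as the inner product of
    F = pi(g) e_n with e_m, and expand F in monomials.  After the substitution
    t_j = - (c_j / a) z_j one has

      F(z) = C (1 - sum_j t_j)^(- sigma - |n|) prod_i (1 - sum_j U_ij t_j)^(n_i)

    with C = sqrt((sigma)_|n| / n!) a^(-sigma) p^n
    ([bergman_rep_meixner]); the last two factors are exactly the generating
    function of the Meixner polynomials at the integral point n, so the
    coefficient of z^m in F is C (-1)^|m| p'^m (sigma)_|m| / m! M_m(n).  Since
    the monomials are orthogonal in the Bergman space, with
    ||z^m||^2 = m! / (sigma)_|m|, taking the inner product with e_m gives the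
    formula.  Each of these steps needs some analysis.

    Extracting a coefficient ([cint_coefficient]).  If power series partial
    sums converge to f uniformly on the unit ball, the integral of
    f conj(z^m) (1 - ||z||^2)^alpha sees the coefficient of z^m alone.
    Orthogonality holds because the integral is invariant under rotating one
    coordinate by u = (3 + 4i) / 5, which multiplies z^n conj(z^m) by
    u^(n_j) conj(u)^(m_j); this factor is not 1 when n_j <> m_j because u is not
    a root of unity.  That rotation preserves Lebesgue measure because it is a
    product of three shears, each of which is a family of translations of the
    line.

    Norms of monomials ([dirichlet_integral]).  Integrating one complex
    coordinate at a time reduces the norms to the radial integrals
    B(m, al) of |z|^(2m) (1 - |z|^2)^al over the unit disc.  Homogeneity in
    the radius and a squeeze on difference quotients give
    (m + al + 2) B(m, al + 1) = (al + 1) B(m, al), and with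
    B(m + 1, al) + B(m, al + 1) = B(m, al) this determines B(m, al) up to the
    area of the disc, which cancels in the normalization.

    Convergence ([uniform_has_sum_negbin], [expandable_prod]).  The multinomial
    theorem reduces (1 - sum_j t_j)^(-N) to the negative binomial series in one
    variable; it converges uniformly where sum_j |t_j| <= x < 1, and
    multiplying by the linear factors 1 - sum_j U_ij t_j preserves uniform
    expandability.  For g in SU(1,d) the first column gives
    |a|^2 = 1 + ||c||^2, hence sum_j |c_j / a|^2 < 1, and the arithmetic-geometric
    mean inequality bounds sum_j |t_j| on the whole ball by a constant below 1.

    Uniqueness ([power_series_inj]).  The Meixner polynomials are defined as
    some family satisfying the generating identity for small t.  Unconditional
    convergence at the single point (s, ..., s) is absolute, hence uniform on
    the polydisc of radius s, and coefficient extraction on a scaled ball then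
    shows that the family is unique. *)

(** * Maps that rescale a measure *)

(** The measure-preserving case is [scales_measure m nng1 f]; the explicit
    [NngNum] makes its value reduce to 1. *)
Definition nng1 {R : realType} : {nonneg R} := NngNum ler01.

Lemma nng1M {R : realType} : nng1%:num = nng1%:num * nng1%:num :> R.
Proof. by rewrite /= mulr1. Qed.

Section measure_scaling.
Local Open Scope ereal_scope.

Definition scales_measure d (T : measurableType d) (R : realType)
    (m : set T -> \bar R) (k : {nonneg R}) (f : T -> T) :=
  measurable_fun setT f /\
  forall A, measurable A -> m (f @^-1` A) = k%:num%:E * m A.

Context {R : realType}.

Lemma measurable_preimageT d1 d2 (T1 : measurableType d1)
    (T2 : measurableType d2) (f : T1 -> T2) (A : set T2) :
  measurable_fun setT f -> measurable A -> measurable (f @^-1` A).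
Proof. by move=> mf mA; rewrite -[X in measurable X]setTI; exact: mf. Qed.

Lemma scales_measure_ge0_integral d (T : measurableType d)
    (m : {measure set T -> \bar R}) k f (h : T -> \bar R) :
    scales_measure m k f -> measurable_fun [set: T] h -> (forall x, 0 <= h x) ->
  \int[m]_x h (f x) = k%:num%:E * \int[m]_x h x.
Proof.
move=> [mf mk] mh h0.
transitivity (\int[pushforward m f]_y h y).
  by rewrite (ge0_integral_pushforward mf m)//= preimage_setT.
rewrite -ge0_integral_mscale//.
by apply: eq_measure_integral => A mA _; exact: mk.
Qed.

(** Positive and negative parts transform separately, by the nonnegative
    case; for integrals that are both infinite the two sides still agree. *)
Lemma scales_measure_integral d (T : measurableType d)
    (m : {measure set T -> \bar R}) f (h : T -> \bar R) :
    scales_measure m nng1 f -> measurable_fun [set: T] h ->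
  \int[m]_x h (f x) = \int[m]_x h x.
Proof.
move=> sf mh; rewrite integralE [RHS]integralE.
have spos (u : T -> \bar R) : measurable_fun setT u -> (forall x, 0 <= u x) ->
    \int[m]_x u (f x) = \int[m]_x u x.
  by move=> mu u0; rewrite (scales_measure_ge0_integral sf)// mul1e.
rewrite -(spos (h^\+)%E) -1?(spos (h^\-)%E)//.
- by rewrite -[fun x0 => h (f x0)]/(h \o f) funepos_comp funeneg_comp.
- exact: measurable_funeneg.
- exact: measurable_funepos.
Qed.

Lemma eq_scales_measure d (T : measurableType d) (m : set T -> \bar R)
    (k : {nonneg R}) (f g : T -> T) :
  f =1 g -> scales_measure m k f -> scales_measure m k g.
Proof. by move=> /funext ->. Qed.

Lemma scales_measure_comp d (T : measurableType d)
    (m : set T -> \bar R) (k1 k2 k : {nonneg R}) (f g : T -> T) :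
    (k%:num = k1%:num * k2%:num)%R ->
  scales_measure m k1 f -> scales_measure m k2 g -> scales_measure m k (g \o f).
Proof.
move=> kE [mf sf] [mg sg]; split; first exact: measurableT_comp.
move=> A mA; rewrite comp_preimage sf ?sg ?kE ?EFinM ?muleA//.
exact: measurable_preimageT.
Qed.

(** Both sides are measures in the set, and they agree on half-open
    intervals. *)
Lemma scales_lebesgue (k : {nonneg R}) (s : R) : (0 < k%:num)%R ->
  scales_measure (@lebesgue_measure R) k (fun x => k%:num^-1 * x + s)%R.
Proof.
move=> k0; set r := k%:num in k0 *.
have mf' : measurable_fun [set: R] (fun x : R => (r^-1 * x + s)%R).
  by apply: measurable_funD => //; exact: measurable_funM.
have mf : measurable_fun [set: measurableTypeR R]
    ((fun x : R => r^-1 * x + s)%R : measurableTypeR R -> measurableTypeR R).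
  exact: mf'.
have ri : (0 <= r^-1)%R by rewrite invr_ge0 ltW.
split=> // A mA.
pose f : measurableTypeR R -> measurableTypeR R := (fun x => r^-1 * x + s)%R.
rewrite -/f in mf *.
pose mu : {measure set (measurableTypeR R) -> \bar R} :=
  mscale (NngNum ri) (pushforward (@lebesgue_measure R) f).
have muE : forall B, mu mf B = (r^-1)%:E * lebesgue_measure (f @^-1` B) by [].
rewrite [in RHS](@lebesgue_measure_unique R (mu mf)) ?muE//.
  by rewrite /= muleA -EFinM divff ?mul1e// gt_eqF.
move=> X [[x y] _ <-]; rewrite muE/=.
have -> : f @^-1` `]x, y]%classic = `](r * (x - s))%R, (r * (y - s))%R]%classic.
  by apply/seteqP; split=> z/=; rewrite !in_itv/= /f
    -ltrBlDr -lerBrDr ltr_pdivlMl// ler_pdivrMl.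
rewrite !lebesgue_measure_itv/= !lte_fin ltr_pM2l// ltrD2r.
case: ifP => _; last by rewrite mule0.
by rewrite -!EFinD -EFinM; congr EFin; field; rewrite gt_eqF.
Qed.

Section skew_products.
Context d1 d2 (T1 : measurableType d1) (T2 : measurableType d2).
Variables (m1 : {sigma_finite_measure set T1 -> \bar R})
          (m2 : {sigma_finite_measure set T2 -> \bar R}).

(** A map acting on the second coordinate, in a way that may depend on the
    first, rescales every section by the same factor, hence also the product
    measure.  Shears and homotheties of the plane and coordinatewise maps on
    tuples are built from this lemma and its mirror image. *)
Lemma scales_skew_snd k (f : T1 -> T2 -> T2) :
    measurable_fun setT (fun z : T1 * T2 => f z.1 z.2) ->
    (forall x, scales_measure m2 k (f x)) ->
  scales_measure (m1 \x m2) k (fun z => (z.1, f z.1 z.2)).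
Proof.
move=> mf sf.
have mg : measurable_fun setT (fun z : T1 * T2 => (z.1, f z.1 z.2)).
  exact: measurable_fun_pair.
split=> // A mA; rewrite /product_measure1.
rewrite -ge0_integralZl//; last first.
  exact: measurable_fun_xsection.
apply: eq_integral => x _ /=.
rewrite -(sf x).2; last exact: measurable_xsection.
congr (m2 _); apply/seteqP; split => y/=;
  by rewrite /xsection/= !inE.
Qed.

Lemma product_measure12 A : measurable A -> (m1 \x m2) A = (m1 \x^ m2) A.
Proof.
by apply: product_measure_unique => B C mB mC; rewrite /= product_measure2E.
Qed.

Lemma scales_skew_fst k (f : T2 -> T1 -> T1) :
    measurable_fun setT (fun z : T1 * T2 => f z.2 z.1) ->
    (forall y, scales_measure m1 k (f y)) ->
  scales_measure (m1 \x m2) k (fun z => (f z.2 z.1, z.2)).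
Proof.
move=> mf sf.
have mg : measurable_fun setT (fun z : T1 * T2 => (f z.2 z.1, z.2)).
  exact: measurable_fun_pair.
split=> // A mA; rewrite !product_measure12//; last exact: measurable_preimageT.
rewrite /product_measure2 -ge0_integralZl//; last first.
  exact: measurable_fun_ysection.
apply: eq_integral => y _ /=.
rewrite -(sf y).2; last exact: measurable_ysection.
congr (m1 _); apply/seteqP; split => x/=;
  by rewrite /ysection/= !inE.
Qed.

End skew_products.

(** The measure on (n+1)-tuples is the image of a product measure under
    [tuple_cons], so the map splits into an action on the head followed by an
    action on the tail. *)
Lemma scales_tuple_measure d (T : measurableType d)
    (m : {sigma_finite_measure set T -> \bar R}) n (f : nat -> T -> T) :
    (forall i, scales_measure m nng1 (f i)) ->
  scales_measure (tuple_measure m n) nng1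
    (fun t => [tuple f i (tnth t i) | i < n]).
Proof.
elim: n f => [|n IHn] f sf.
  rewrite (_ : (fun _ => _) = id); last by apply/funext => t; rewrite [LHS]tuple0 [RHS]tuple0.
  by split=> [|A mA]; rewrite ?preimage_id ?mul1e.
have [mg sg] := IHn (fun i => f i.+1) (fun i => sf i.+1).
set g := (fun t => _) in mg sg.
have mG : measurable_fun setT
    (fun t : n.+1.-tuple T => [tuple f i (tnth t i) | i < n.+1]).
  apply/measurable_fun_tnthP => i /=.
  rewrite (_ : _ \o _ = (f i) \o (@tnth _ _ ^~ i)); last first.
    by apply/funext => t /=; rewrite tnth_mktuple.
  apply: measurableT_comp; [exact: (sf _).1|exact: measurable_tnth].
split=> // A mA.
rewrite /= /tuple_cons_measure /pushforward.
set B := @tuple_cons _ T n @^-1` A.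
have mB : measurable B.
  by apply: measurable_preimageT mA; exact: measurable_tuple_cons.
have -> : @tuple_cons _ T n @^-1`
    ((fun t => [tuple f i (tnth t i) | i < n.+1]) @^-1` A) =
    ((fun z => (z.1, g z.2)) \o (fun z => (f 0%N z.1, z.2))) @^-1` B.
  rewrite /B /preimage; apply/funext => -[x t] /=; congr A.
  apply: eq_from_tnth => i; rewrite tnth_mktuple.
  case: (unliftP ord0 i) => [j ->|->]; last by rewrite !(tnth_nth x).
  by rewrite /tuple_cons/= !tnthS tnth_mktuple.
apply: (scales_measure_comp nng1M _ _).2 => //.
  apply: (@scales_skew_fst _ _ _ _ m (tuple_measure m n) _ (fun=> f 0%N)) => //.
  by apply: measurableT_comp => //; exact: (sf 0%N).1.
apply: (@scales_skew_snd _ _ _ _ m (tuple_measure m n) _ (fun=> g)) => //.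
exact: measurableT_comp.
Qed.

End measure_scaling.

(** * Rotations, homotheties and radial integrals in the plane *)

Section plane.
Context {R : realType}.
Local Notation plane := (@lebesgue_plane R).

Lemma measurable_plane_fst : measurable_fun [set: planeR R] (fun z => z.1 : R).
Proof. exact: (@measurable_fst _ _ (measurableTypeR R) (measurableTypeR R)). Qed.

Lemma measurable_plane_snd : measurable_fun [set: planeR R] (fun z => z.2 : R).
Proof. exact: (@measurable_snd _ _ (measurableTypeR R) (measurableTypeR R)). Qed.

Lemma scales_plane_fst (k : {nonneg R}) (s : R) : 0 < k%:num ->
  scales_measure plane k
    (fun z : planeR R => (k%:num^-1 * z.1 + s * z.2, z.2)).
Proof.
move=> k0.
apply: (@scales_skew_fst _ _ _ _ _ lebesgue_measure lebesgue_measure k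
  (fun y x => k%:num^-1 * x + s * y)); last by move=> y; exact: scales_lebesgue.
have m1 := measurable_plane_fst; have m2 := measurable_plane_snd.
suff : measurable_fun [set: planeR R]
  (fun z : planeR R => k%:num^-1 * z.1 + s * z.2) by [].
by apply: measurable_funD; apply: measurable_funM.
Qed.

Lemma scales_plane_snd (k : {nonneg R}) (s : R) : 0 < k%:num ->
  scales_measure plane k
    (fun z : planeR R => (z.1, k%:num^-1 * z.2 + s * z.1)).
Proof.
move=> k0.
apply: (@scales_skew_snd _ _ _ _ _ lebesgue_measure lebesgue_measure k
  (fun x y => k%:num^-1 * y + s * x)); last by move=> y; exact: scales_lebesgue.
have m1 := measurable_plane_fst; have m2 := measurable_plane_snd.
suff : measurable_fun [set: planeR R]
  (fun z : planeR R => k%:num^-1 * z.2 + s * z.1) by [].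
by apply: measurable_funD; apply: measurable_funM.
Qed.

(** Multiplication by (3 + 4i) / 5, a unit complex number with rational
    coordinates that is not a root of unity. *)
Definition rotation (z : planeR R) : planeR R :=
  (3 / 5 * z.1 - 4 / 5 * z.2, 4 / 5 * z.1 + 3 / 5 * z.2).

(** A rotation by the angle theta is a product of three shears, with slopes
    - tan (theta / 2), sin theta and - tan (theta / 2); here these are
    - 1/2, 4/5 and - 1/2. *)
Lemma rotation_preserves_plane : scales_measure plane nng1 rotation.
Proof.
have H x := @scales_plane_fst nng1 x ltr01.
have V x := @scales_plane_snd nng1 x ltr01.
apply: eq_scales_measure (scales_measure_comp nng1M (H (- 2^-1))
  (scales_measure_comp nng1M (V (4 / 5)) (H (- 2^-1)))) => z.
by rewrite /rotation/= !invr1 !mul1r; congr pair; field.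
Qed.

Lemma homothety_scales_plane (r : R) (k : {nonneg R}) : 0 < r ->
    k%:num = r ^+ 2 ->
  scales_measure plane k (fun z : planeR R => (r^-1 * z.1, r^-1 * z.2)).
Proof.
move=> r0 kE.
have kk : k%:num = (NngNum (ltW r0))%:num * (NngNum (ltW r0))%:num by rewrite kE.
apply: eq_scales_measure (scales_measure_comp kk
  (@scales_plane_fst (NngNum (ltW r0)) 0 r0)
  (@scales_plane_snd (NngNum (ltW r0)) 0 r0)) => z.
by rewrite /= !mul0r !addr0.
Qed.

Definition sqnorm (z : planeR R) : R := z.1 ^+ 2 + z.2 ^+ 2.

Lemma sqnorm_ge0 z : 0 <= sqnorm z.
Proof. by rewrite addr_ge0// sqr_ge0. Qed.

(** Truncating s ^ n to positive s turns integrals over a ball of squared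
    radius s into integrals over the whole space.  The cut is strict so that
    the exponent 0 gives the indicator function of the open ball. *)
Definition truncpow (n : nat) (s : R) : R := if 0 < s then s ^+ n else 0.

Lemma truncpow_ge0 n s : 0 <= truncpow n s.
Proof. by rewrite /truncpow; case: ifP => // /ltW s0; rewrite exprn_ge0. Qed.

Lemma measurable_sqnorm : measurable_fun [set: planeR R] sqnorm.
Proof.
have m1 := measurable_plane_fst; have m2 := measurable_plane_snd.
by apply: measurable_funD; apply: measurable_funX.
Qed.

Lemma measurable_truncpow n : measurable_fun [set: R] (truncpow n).
Proof.
apply: measurable_fun_ifT => //; exact: measurable_fun_ltr.
Qed.

Definition radial_integrand (m al : nat) (s : R) (z : planeR R) : R :=
  sqnorm z ^+ m * truncpow al (s - sqnorm z).

Lemma radial_integrand_ge0 m al s z : 0 <= radial_integrand m al s z.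
Proof. by rewrite mulr_ge0 ?truncpow_ge0// exprn_ge0// sqnorm_ge0. Qed.

Lemma measurable_radial_integrand m al s :
  measurable_fun [set: planeR R] (EFin \o radial_integrand m al s).
Proof.
apply/measurable_EFinP; apply: measurable_funM.
  by apply: measurable_funX; exact: measurable_sqnorm.
apply: (measurableT_comp (measurable_truncpow al)).
by apply: measurable_funB => //; exact: measurable_sqnorm.
Qed.

Definition radial_integral (m al : nat) (s : R) : \bar R :=
  (\int[plane]_z (radial_integrand m al s z)%:E)%E.

(** The substitution z = sqrt(s) z' contributes s from the area element and
    s ^ (m + al) from the integrand. *)
Lemma radial_integral_scale m al (s : R) : 0 < s ->
  radial_integral m al s = ((s ^+ (m + al).+1)%:E * radial_integral m al 1)%E.
Proof.
move=> s0; have r0 : 0 < Num.sqrt s by rewrite sqrtr_gt0.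
have rE : Num.sqrt s ^+ 2 = s by rewrite sqr_sqrtr// ltW.
have sc := @homothety_scales_plane (Num.sqrt s) (NngNum (ltW s0)) r0 (esym rE).
have sE z : sqnorm ((Num.sqrt s)^-1 * z.1, (Num.sqrt s)^-1 * z.2) = s^-1 * sqnorm z.
  by rewrite /sqnorm/= !exprMn !exprVn rE mulrDr.
have hE z : radial_integrand m al s z = s ^+ (m + al) *
   radial_integrand m al 1 ((Num.sqrt s)^-1 * z.1, (Num.sqrt s)^-1 * z.2).
  rewrite /radial_integrand sE exprMn /truncpow.
  have -> : 1 - s^-1 * sqnorm z = s^-1 * (s - sqnorm z).
    by field; rewrite gt_eqF.
  rewrite pmulr_rgt0 ?invr_gt0//; case: ifP => _; last by rewrite !mulr0.
  rewrite exprMn exprD !exprVn; field.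
  by rewrite !expf_neq0// gt_eqF.
rewrite /radial_integral; under eq_integral do rewrite hE EFinM.
rewrite ge0_integralZl//.
- rewrite (scales_measure_ge0_integral sc (h := EFin \o radial_integrand m al 1)).
  + by rewrite muleA -EFinM/= exprS mulrC.
  + exact: measurable_radial_integrand.
  + by move=> z; rewrite /= lee_fin radial_integrand_ge0.
- by apply: (measurableT_comp (measurable_radial_integrand m al 1)); exact: sc.1.
- by move=> z _; rewrite lee_fin radial_integrand_ge0.
- by rewrite lee_fin exprn_ge0// ltW.
Qed.

End plane.

(** * Radial beta integrals over the unit disc *)

Section beta_integral.
Context {R : realType}.
Local Notation plane := (@lebesgue_plane R).
Implicit Types (u h x y : R) (m n al : nat).

(** Convexity of the truncated power with exponent n + 1: the increment
    dominates that of the tangent at u. *)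
Lemma truncpow_tangent_le n u h : 0 <= h ->
  n.+1%:R * h * truncpow n u + truncpow n.+1 u <= truncpow n.+1 (u + h).
Proof.
move=> h0; rewrite /truncpow; case: (ltP 0 u) => u0; last first.
  by rewrite mulr0 addr0; case: ifP => // /ltW uh; rewrite exprn_ge0.
have uh : 0 < u + h by rewrite ltr_pwDl.
rewrite uh; elim: n => [|n IHn]; first by rewrite !expr1 expr0; lra.
rewrite [leRHS]exprS; apply: le_trans (ler_wpM2l (ltW uh) IHn).
have un : 0 <= u ^+ n by rewrite exprn_ge0// ltW.
have : 0 <= n.+1%:R * h * h * u ^+ n by rewrite !mulr_ge0.
by rewrite -[n.+2%:R]natr1 !exprS; set X := u ^+ n; set N := n.+1%:R => ?; lra.
Qed.

(** Convexity again, now comparing with the tangent at the right end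
    point u + h. *)
Lemma truncpow_chord_le n u h : 0 <= h ->
  truncpow n.+1 (u + h) <=
  truncpow n.+1 u + n.+1%:R * h * truncpow n (u + h).
Proof.
move=> h0; rewrite /truncpow; case: (ltP 0 (u + h)) => uh; last first.
  by rewrite mulr0 addr0; case: ifP => // /ltW u0; rewrite exprn_ge0.
have vn k : 0 <= (u + h) ^+ k by rewrite exprn_ge0// ltW.
case: (ltP 0 u) => u0; last first.
  rewrite add0r exprS; apply: ler_wpM2r => //.
  by rewrite -natr1 mulrDl mul1r; have := mulr_ge0 (ler0n R n) h0; lra.
elim: n => [|n IHn]; first by rewrite !expr1 expr0; lra.
rewrite [leLHS]exprS; apply: le_trans (ler_wpM2l (ltW uh) IHn) _.
have H : h * u ^+ n.+1 <= h * (u + h) ^+ n.+1.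
  by rewrite ler_wpM2l// lerXn2r ?nnegrE ?(ltW u0) ?(ltW uh)// lerDl.
rewrite -[n.+2%:R]natr1 [u ^+ n.+2]exprS.
rewrite mulrDr [_ * (_ * (u + h) ^+ n)]mulrCA -(exprS (u + h)).
by lra.
Qed.

Lemma radial_integral_ge0 m al s : (0 <= @radial_integral R m al s)%E.
Proof.
by apply: integral_ge0 => z _; rewrite lee_fin radial_integrand_ge0.
Qed.

Lemma lebesgue_plane_itv (x1 y1 x2 y2 : R) : x1 < y1 -> x2 < y2 ->
  plane (`[x1, y1] `*` `[x2, y2])%classic = ((y1 - x1) * (y2 - x2))%:E.
Proof.
move=> xy1 xy2; rewrite /lebesgue_plane product_measure1E//.
change (lebesgue_measure `[x1, y1]%classic * lebesgue_measure `[x2, y2]%classic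
  = ((y1 - x1) * (y2 - x2))%:E)%E.
by rewrite !lebesgue_measure_itv/= !lte_fin xy1 xy2 -!EFinD -EFinM.
Qed.

Lemma radial_integral_lty m al : (@radial_integral R m al 1 < +oo)%E.
Proof.
pose box : set (planeR R) := (`[-1, 1] `*` `[-1, 1])%classic.
have mbox : measurable box by exact: measurableX.
apply: (@le_lt_trans _ _ (plane box)); last first.
  by rewrite lebesgue_plane_itv ?ltry//; lra.
rewrite -(setIT box) -integral_indic//.
apply: ge0_le_integral => //.
- by move=> z _; rewrite lee_fin radial_integrand_ge0.
- exact: measurable_radial_integrand.
- exact/measurable_EFinP/measurable_indic.
move=> z _; rewrite lee_fin /radial_integrand /truncpow indicE subr_gt0.
case: ltP => z1; last by rewrite mulr0.
have := sqnorm_ge0 z => z0.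
rewrite mem_set; last first.
  have sq x y : x ^+ 2 + y ^+ 2 < 1 -> -1 <= x <= 1.
    by move=> xy; apply/andP; split; nra.
  rewrite /box/= !in_itv/=; split; first exact: sq z1.
  by apply: (sq _ z.1); rewrite addrC.
set r := sqnorm z in z0 z1 *.
by apply: mulr_ile1; rewrite ?exprn_ge0 ?exprn_ile1//; lra.
Qed.

Definition beta_const m al : R := fine (radial_integral m al 1).

Lemma radial_integralE m al s : 0 < s ->
  radial_integral m al s = (s ^+ (m + al).+1 * beta_const m al)%:E.
Proof.
move=> s0; rewrite radial_integral_scale// EFinM fineK//.
by rewrite ge0_fin_numE ?radial_integral_ge0// radial_integral_lty.
Qed.

Lemma radial_integral1E m al : radial_integral m al 1 = (beta_const m al)%:E.
Proof. by rewrite radial_integralE// expr1n mul1r. Qed.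

Lemma beta_const_ge0 m al : 0 <= beta_const m al.
Proof. by rewrite fine_ge0// radial_integral_ge0. Qed.

Lemma beta_const00_gt0 : 0 < beta_const 0 0.
Proof.
pose box : set (planeR R) := (`[0, 2^-1] `*` `[0, 2^-1])%classic.
have mbox : measurable box by exact: measurableX.
rewrite -lte_fin -radial_integral1E.
apply: (@lt_le_trans _ _ (plane box)).
  by rewrite lebesgue_plane_itv ?lte_fin//; lra.
rewrite -(setIT box) -integral_indic//.
apply: ge0_le_integral => //.
- exact/measurable_EFinP/measurable_indic.
- exact: measurable_radial_integrand.
move=> z _; rewrite lee_fin indicE.
case: (boolP (z \in box)) => [|_]; last exact: radial_integrand_ge0.
rewrite inE /box/= !in_itv/= => -[/andP[a b] /andP[c e]].
rewrite /radial_integrand /truncpow !expr0 mul1r ifT//.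
have sq x : 0 <= x -> x <= 2^-1 -> x ^+ 2 <= 4^-1 by move=> *; nra.
by have := sq _ a b; have := sq _ c e; rewrite subr_gt0 /sqnorm; lra.
Qed.

(** The inequalities between truncated powers are kept in additive form, so
    that they can be integrated without leaving nonnegative functions. *)
Lemma radial_integral_lin m n al be s t x : 0 <= x ->
  (\int[plane]_z (x * radial_integrand m al s z + radial_integrand n be t z)%:E =
   x%:E * radial_integral m al s + radial_integral n be t)%E.
Proof.
move=> x0; under eq_integral do rewrite EFinD EFinM.
have mx : measurable_fun [set: planeR R]
    (fun z => x%:E * (radial_integrand m al s z)%:E)%E.
  by apply: emeasurable_funM => //; exact: measurable_radial_integrand.
rewrite ge0_integralD//.
- rewrite ge0_integralZl//; first exact: measurable_radial_integrand.
  by move=> z _; rewrite lee_fin radial_integrand_ge0.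
- by move=> z _; rewrite mule_ge0 ?lee_fin ?radial_integrand_ge0.
- by move=> z _; rewrite lee_fin radial_integrand_ge0.
- exact: measurable_radial_integrand.
Qed.

Lemma measurable_radial_lin m n al be s t x :
  measurable_fun [set: planeR R] (fun z =>
    (x * radial_integrand m al s z + radial_integrand n be t z)%:E).
Proof.
apply/measurable_EFinP; apply: measurable_funD.
  apply: measurable_funM => //.
  by apply/measurable_EFinP; exact: measurable_radial_integrand.
by apply/measurable_EFinP; exact: measurable_radial_integrand.
Qed.

(** Comes from r (1 - r) ^ al + (1 - r) ^ (al + 1) = (1 - r) ^ al. *)
Lemma beta_const_recr m al :
  beta_const m.+1 al + beta_const m al.+1 = beta_const m al.
Proof.
apply: EFin_inj; rewrite EFinD -!radial_integral1E.
rewrite -[X in (X + _)%E]mul1e -radial_integral_lin//.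
apply: eq_integral => z _; congr EFin; rewrite mul1r /radial_integrand /truncpow.
by case: ifP => _; rewrite ?exprS; ring.
Qed.

Lemma beta_const_tangent_le m al h : 0 <= h ->
  al.+1%:R * h * beta_const m al + beta_const m al.+1 <=
  (1 + h) ^+ (m + al).+2 * beta_const m al.+1.
Proof.
move=> h0; have h1 : 0 < 1 + h by rewrite ltr_pwDl.
rewrite -addnS -lee_fin -radial_integralE//.
rewrite EFinD EFinM -!radial_integral1E -radial_integral_lin ?mulr_ge0//.
apply: ge0_le_integral => //.
- by move=> z _; rewrite lee_fin addr_ge0 ?mulr_ge0 ?exprn_ge0 ?truncpow_ge0 ?sqnorm_ge0.
- exact: measurable_radial_lin.
- exact: measurable_radial_integrand.
move=> z _; rewrite lee_fin /radial_integrand mulrCA -mulrDr.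
rewrite ler_wpM2l// ?exprn_ge0 ?sqnorm_ge0// addrAC.
exact: truncpow_tangent_le.
Qed.

Lemma beta_const_chord_le m al h : 0 <= h ->
  (1 + h) ^+ (m + al).+2 * beta_const m al.+1 <=
  al.+1%:R * h * ((1 + h) ^+ (m + al).+1 * beta_const m al) + beta_const m al.+1.
Proof.
move=> h0; have h1 : 0 < 1 + h by rewrite ltr_pwDl.
rewrite -lee_fin -[X in X.+1]addnS -radial_integralE//.
rewrite EFinD EFinM -radial_integralE// -!radial_integral1E.
rewrite -radial_integral_lin ?mulr_ge0//.
apply: ge0_le_integral => //.
- by move=> z _; rewrite lee_fin radial_integrand_ge0.
- exact: measurable_radial_integrand.
- exact: measurable_radial_lin.
move=> z _; rewrite lee_fin /radial_integrand mulrCA -mulrDr.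
rewrite ler_wpM2l// ?exprn_ge0 ?sqnorm_ge0// addrAC [leRHS]addrC.
exact: truncpow_chord_le.
Qed.

(** The passage to the limit h -> 0 in the difference quotients, made
    explicit by the Bernoulli-type bound (1 - n h) (1 + h) ^ n <= 1. *)
Lemma le_of_le_expr1D x y n :
  (forall h, 0 < h -> x <= y * (1 + h) ^+ n) -> 0 <= y -> x <= y.
Proof.
move=> H y0; case: (leP x 0) => [x0|x0]; first exact: le_trans x0 y0.
have B h : 0 < h -> (1 - n%:R * h) * (1 + h) ^+ n <= 1.
  move=> h0; elim: {H} n => [|n IHn]; first by rewrite expr0; lra.
  apply: le_trans IHn; rewrite exprS mulrA ler_wpM2r ?exprn_ge0//; first lra.
  rewrite -natr1; have : 0 <= n%:R * h * h by rewrite !mulr_ge0// ltW.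
  by set N := n%:R; nra.
apply/ler_addgt0Pr => e e0.
have N0 : 0 < n.+1%:R :> R by rewrite ltr0n.
pose h := e / (n.+1%:R * x).
have h0 : 0 < h by rewrite divr_gt0// mulr_gt0.
have xh : x * (n%:R * h) <= e.
  have -> : e = x * (n.+1%:R * h) by rewrite /h; field; rewrite !gt_eqF.
  by rewrite ler_pM2l// ler_wpM2r ?(ltW h0)// ler_nat.
have [n1|n1] := leP 0 (1 - n%:R * h); last nra.
have := ler_wpM2r n1 (H h h0); rewrite -mulrA [_ ^+ n * _]mulrC.
have := ler_wpM2l y0 (B h h0); lra.
Qed.

(** By homogeneity the integral over the disc of squared radius 1 + h is
    (1 + h) ^ (m + al + 2) times [beta_const m al.+1]; its derivative at h = 0
    is computed in a second way by differentiating the truncated power under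
    the integral sign.  The tangent and chord inequalities squeeze the
    difference quotient, which replaces the differentiation. *)
Lemma beta_const_recl m al :
  (m + al).+2%:R * beta_const m al.+1 = al.+1%:R * beta_const m al.
Proof.
set q := (m + al).+1.
have sumE h : (1 + h) ^+ q.+1 - 1 = h * \sum_(i < q.+1) (1 + h) ^+ i.
  by rewrite subrX1 [1 + h]addrC addrK.
have b0 := beta_const_ge0 m al; have b1 := beta_const_ge0 m al.+1.
apply/eqP; rewrite eq_le; apply/andP; split.
  apply: (@le_of_le_expr1D _ _ q); last by rewrite mulr_ge0.
  move=> h h0; have := beta_const_chord_le m al (ltW h0); rewrite -/q => H.
  rewrite -(ler_pM2l h0).
  have : h * (q.+1%:R * beta_const m al.+1) <=
         ((1 + h) ^+ q.+1 - 1) * beta_const m al.+1.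
    rewrite sumE -mulrA ler_pM2l// ler_wpM2r//.
    rewrite -[X in X%:R]card_ord -sumr_const ler_sum// => i _.
    by rewrite exprn_ege1//; lra.
  move/le_trans; apply.
  by move: H; set X := (1 + h) ^+ q.+1; set Y := (1 + h) ^+ q; lra.
apply: (@le_of_le_expr1D _ _ q); last by rewrite mulr_ge0.
move=> h h0; have := beta_const_tangent_le m al (ltW h0); rewrite -/q => H.
rewrite -(ler_pM2l h0).
have : ((1 + h) ^+ q.+1 - 1) * beta_const m al.+1 <=
   h * (q.+1%:R * beta_const m al.+1 * (1 + h) ^+ q).
  rewrite sumE -mulrA ler_pM2l// mulrAC ler_wpM2r//.
  rewrite -[X in X%:R]card_ord -sumr_const mulr_suml ler_sum// => i _.
  have iq : (i <= q)%N by rewrite -ltnS.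
  by rewrite mul1r ler_weXn2l// lerDl ltW.
by apply: le_trans; move: H; set X := (1 + h) ^+ q.+1; lra.
Qed.

(** The closed form of the beta integral up to [beta_const 0 0], which is the
    area of the unit disc. *)
Lemma beta_constE m al :
  beta_const m al * (m + al).+1`!%:R = beta_const 0 0 * m`!%:R * al`!%:R.
Proof.
elim: m al => [|m IHm] al.
  elim: al => [|al IHal]; first by rewrite !fact0 !mulr1.
  have := beta_const_recl 0 al; rewrite add0n => H.
  rewrite addnS [(0 + _).+2`!]factS natrM mulrA [_ * _.+2%:R]mulrC.
  by rewrite H -mulrA IHal factS natrM; ring.
have := beta_const_recl m al => H; have H2 := beta_const_recr m al.
rewrite addSn [_.+2`!]factS natrM mulrA.
have -> : beta_const m.+1 al * (m + al).+2%:R = m.+1%:R * beta_const m al.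
  rewrite (_ : beta_const m.+1 al = beta_const m al - beta_const m al.+1); last first.
    by rewrite -H2 addrK.
  rewrite mulrBl [beta_const m al.+1 * _]mulrC H -!natr1 natrD; ring.
by rewrite -mulrA IHm factS natrM; ring.
Qed.

End beta_integral.

(** * Dirichlet integrals over the unit ball *)

Section ball_integral.
Context {R : realType}.
Local Notation plane := (@lebesgue_plane R).
Local Notation kappa := (@beta_const R 0 0).

Definition tuple_sqnorm d (p : d.-tuple (planeR R)) : R :=
  \sum_(i < d) sqnorm (tnth p i).

Definition dirichlet_integrand d (m : 'I_d -> nat) al s
    (p : d.-tuple (planeR R)) : R :=
  (\prod_(i < d) sqnorm (tnth p i) ^+ m i) * truncpow al (s - tuple_sqnorm p).

Lemma dirichlet_integrand_ge0 d (m : 'I_d -> nat) al s p :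
  0 <= dirichlet_integrand m al s p.
Proof.
rewrite mulr_ge0 ?truncpow_ge0// prodr_ge0// => i _.
by rewrite exprn_ge0// sqnorm_ge0.
Qed.

Lemma measurable_sqnorm_tnth d (i : 'I_d) :
  measurable_fun [set: d.-tuple (planeR R)] (fun p => sqnorm (tnth p i)).
Proof.
apply: (measurableT_comp (@measurable_sqnorm R)); exact: measurable_tnth.
Qed.

Lemma measurable_tuple_sqnorm d :
  measurable_fun [set: d.-tuple (planeR R)] (@tuple_sqnorm d).
Proof. by apply: measurable_sum => i; exact: measurable_sqnorm_tnth. Qed.

Lemma measurable_dirichlet_integrand d (m : 'I_d -> nat) al s :
  measurable_fun [set: d.-tuple (planeR R)] (EFin \o dirichlet_integrand m al s).
Proof.
apply/measurable_EFinP; apply: measurable_funM.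
  apply: measurable_prod => i _.
  by apply: measurable_funX; exact: measurable_sqnorm_tnth.
apply: (measurableT_comp (measurable_truncpow al)).
by apply: measurable_funB => //; exact: measurable_tuple_sqnorm.
Qed.

Lemma tuple_sqnorm_ge0 d (p : d.-tuple (planeR R)) : 0 <= tuple_sqnorm p.
Proof. by apply: sumr_ge0 => i _; exact: sqnorm_ge0. Qed.

Lemma ge0_integral_volumeS d (f : d.+1.-tuple (planeR R) -> \bar R) :
    measurable_fun [set: d.+1.-tuple (planeR R)] f -> (forall p, 0 <= f p)%E ->
  (\int[volume R d.+1]_p f p =
   \int[plane]_z \int[volume R d]_p f (tuple_cons (z, p)))%E.
Proof.
move=> mf f0.
have mc := @measurable_tuple_cons _ (planeR R) d.
transitivity (\int[plane \x volume R d]_zp f (tuple_cons zp))%E.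
  transitivity (\int[pushforward (plane \x volume R d)%E (@tuple_cons _ (planeR R) d)]_y f y)%E.
    by [].
  by rewrite (ge0_integral_pushforward mc)//= preimage_setT.
rewrite fubini_tonelli1//.
exact: measurableT_comp.
Qed.

(** Induction on the dimension: for a fixed first coordinate z the remaining
    integral is the same one with s replaced by s - |z|^2, hence a multiple of a
    truncated power, and the integral over z is then a radial beta integral. *)
Lemma dirichlet_integral d (m : 'I_d -> nat) al s :
  (\int[volume R d]_p (dirichlet_integrand m al s p)%:E =
   (kappa ^+ d * (\prod_(i < d) (m i)`!)%N%:R * al`!%:R /
    (al + d + \sum_(i < d) m i)`!%:R * truncpow (al + d + \sum_(i < d) m i) s)%:E)%E.
Proof.
elim: d m al s => [|d IHd] m al s.
  rewrite integral_dirac//; last exact: measurable_dirichlet_integrand.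
  rewrite diracT mul1e /dirichlet_integrand /tuple_sqnorm !big_ord0.
  rewrite subr0 !mul1r !addn0 divff ?mul1r//.
rewrite ge0_integral_volumeS; first last.
- by move=> p; rewrite lee_fin dirichlet_integrand_ge0.
- exact: measurable_dirichlet_integrand.
set m' := fun i : 'I_d => m (lift ord0 i).
pose N := (al + d + \sum_(i < d) m' i)%N.
pose C : R := kappa ^+ d * (\prod_(i < d) (m' i)`!)%N%:R * al`!%:R / N`!%:R.
have C0 : 0 <= C.
  by rewrite /C !mulr_ge0 ?invr_ge0// exprn_ge0// beta_const_ge0.
have consE z p : dirichlet_integrand m al s (tuple_cons (z, p)) =
    sqnorm z ^+ m ord0 * dirichlet_integrand m' al (s - sqnorm z) p.
  rewrite /dirichlet_integrand /tuple_sqnorm !big_ord_recl/=.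
  rewrite opprD !addrA -mulrA; congr (_ * (_ * truncpow _ (_ - _))).
    by apply: eq_bigr => i _; rewrite tnthS.
  by apply: eq_bigr => i _; rewrite tnthS.
transitivity (\int[plane]_z (C%:E * (radial_integrand (m ord0) N s z)%:E))%E.
  apply: eq_integral => z _.
  under eq_integral do rewrite consE EFinM.
  rewrite ge0_integralZl//.
  - by rewrite IHd -!EFinM /radial_integrand -/N -/C; congr EFin; ring.
  - exact: measurable_dirichlet_integrand.
  - by move=> p _; rewrite lee_fin dirichlet_integrand_ge0.
  - by rewrite lee_fin exprn_ge0// sqnorm_ge0.
rewrite ge0_integralZl//; first last.
- by move=> z _; rewrite lee_fin radial_integrand_ge0.
- exact: measurable_radial_integrand.
rewrite -/(radial_integral (m ord0) N s).
have fN k : k`!%:R != 0 :> R by rewrite pnatr_eq0 -lt0n fact_gt0.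
have -> : (al + d.+1 + \sum_(i < d.+1) m i = (m ord0 + N).+1)%N.
  by rewrite big_ord_recl /N /m'; lia.
rewrite /truncpow; case: ltP => s0; last first.
  rewrite mulr0 (_ : radial_integral _ _ _ = 0%E) ?mule0//.
  apply: integral0_eq => z _; rewrite /radial_integrand /truncpow.
  by rewrite ltNge subr_le0 (le_trans s0 (sqnorm_ge0 z)) mulr0.
rewrite radial_integralE// -EFinM; congr EFin.
have -> : beta_const (m ord0) N =
    kappa * (m ord0)`!%:R * N`!%:R / (m ord0 + N).+1`!%:R.
  by apply: (mulIf (fN (m ord0 + N).+1)); rewrite beta_constE divfK.
by rewrite big_ord_recl natrM [kappa ^+ _.+1]exprS /C /m'; field; rewrite !fN.
Qed.

End ball_integral.

(** * Modulus of complex numbers and uniform summation *)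

Section complex_norm.
Context {R : realType}.
Implicit Types (x y : R[i]).

Lemma normc_ge0 x : 0 <= normc x.
Proof. by case: x => a b; exact: sqrtr_ge0. Qed.

Lemma sqr_normcE x : normc x ^+ 2 = Re x ^+ 2 + Im x ^+ 2.
Proof. by case: x => a b; rewrite /= sqr_sqrtr// addr_ge0// sqr_ge0. Qed.

Lemma normcX x n : normc (x ^+ n) = normc x ^+ n.
Proof. by elim: n => [|n IHn]; rewrite ?normc1// !exprS normcM IHn. Qed.

Lemma normc_prod (I : Type) (r : seq I) (F : I -> R[i]) :
  normc (\prod_(i <- r) F i) = \prod_(i <- r) normc (F i).
Proof. by apply: (big_morph (@normc R)) => [x y|]; rewrite ?normcM ?normc1. Qed.

Lemma le_normc_sum (I : Type) (r : seq I) (F : I -> R[i]) :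
  normc (\sum_(i <- r) F i) <= \sum_(i <- r) normc (F i).
Proof.
elim/big_rec2: _ => [|i a x _ IHx]; first by rewrite normc0.
by apply: le_trans (le_normcD _ _) _; rewrite lerD2l.
Qed.

Lemma normc_real (a : R) : normc a%:C = `|a|.
Proof. by rewrite /= expr0n/= addr0 sqrtr_sqr. Qed.

Lemma Re_le_normc x : `|Re x| <= normc x.
Proof.
rewrite -ler_sqr ?nnegrE ?normc_ge0// sqr_normcE real_normK ?num_real//.
by rewrite lerDl sqr_ge0.
Qed.

Lemma Im_le_normc x : `|Im x| <= normc x.
Proof.
rewrite -ler_sqr ?nnegrE ?normc_ge0// sqr_normcE real_normK ?num_real//.
by rewrite lerDr sqr_ge0.
Qed.

Lemma normc_le_Re_Im x : normc x <= `|Re x| + `|Im x|.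
Proof.
rewrite -ler_sqr ?nnegrE ?normc_ge0 ?addr_ge0// sqr_normcE sqrrD.
have := mulr_ge0 (normr_ge0 (Re x)) (normr_ge0 (Im x)).
by rewrite !real_normK ?num_real//; set y := _ * _ => ?; lra.
Qed.

Lemma mul_conjc x : x * (Num.conj x) = (normc x ^+ 2)%:C.
Proof. rewrite sqr_normcE; case: x => a b; rewrite /Num.conj/=.
by simpc; congr Complex; ring. Qed.

Lemma normc_conj x : normc (Num.conj x) = normc x.
Proof. by case: x => a b; rewrite /= sqrrN. Qed.

Lemma Re_sub x y : Re (x - y) = Re x - Re y. Proof. by case: x; case: y. Qed.
Lemma Im_sub x y : Im (x - y) = Im x - Im y. Proof. by case: x; case: y. Qed.
Lemma Re_add x y : Re (x + y) = Re x + Re y. Proof. by case: x; case: y. Qed.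
Lemma Im_add x y : Im (x + y) = Im x + Im y. Proof. by case: x; case: y. Qed.
Lemma Re_mul x y : Re (x * y) = Re x * Re y - Im x * Im y.
Proof. by case: x; case: y. Qed.
Lemma Im_mul x y : Im (x * y) = Re x * Im y + Im x * Re y.
Proof. by case: x => a b; case: y => c e; rewrite /=; ring. Qed.

Lemma normc_small_eq x y :
  (forall e : R, 0 < e -> normc (x - y) <= e) -> x = y.
Proof.
move=> H; apply/eqP; rewrite -subr_eq0; apply/eqP; apply: eq0_normc.
apply/eqP; rewrite eq_le normc_ge0 andbT; apply/ler_addgt0Pr => e e0.
by rewrite add0r H.
Qed.

End complex_norm.

Section uniform_sum.
Context {R : realType} {I : choiceType} {T : Type}.

(** Unconditional summation, uniformly in a parameter t ranging over S. *)
Definition uniform_has_sum (S : set T) (u : I -> T -> R[i]) (F : T -> R[i]) :=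
  forall e : R, 0 < e -> exists A : {fset I}, forall B : {fset I},
    (A `<=` B)%fset -> forall t, S t ->
    normc (\sum_(n <- enum_fset B) u n t - F t) < e.

End uniform_sum.

(** * Weighted integration over the unit ball *)

Section weighted_ball.
Context {R : realType} {d : nat} (alpha : nat).
Local Notation T := (d.-tuple (planeR R)).
Local Notation mu := (volume R d).
Local Notation ball := (@unit_ball R d).
Local Notation kappa := (@beta_const R 0 0).
Local Notation w p := (bergman_weight alpha (Defs.cpoint p)).
Implicit Types (p : T) (g : T -> R).

Lemma sqr_hnorm (z : 'cV[R[i]]_d) : hnorm z ^+ 2 = \sum_i normc (z i 0) ^+ 2.
Proof. by rewrite sqr_sqrtr// sumr_ge0// => i _; exact: sqr_ge0. Qed.

Lemma normc_cpoint p i : normc (Defs.cpoint p i 0) ^+ 2 = sqnorm (tnth p i).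
Proof. by rewrite sqr_normcE mxE. Qed.

Lemma hnorm_cpoint p : hnorm (Defs.cpoint p) ^+ 2 = tuple_sqnorm p.
Proof. by rewrite sqr_hnorm; apply: eq_bigr => i _; rewrite normc_cpoint. Qed.

Lemma unit_ballP p : ball p <-> tuple_sqnorm p < 1.
Proof.
have -> : (tuple_sqnorm p < 1) = (hnorm (Defs.cpoint p) < 1); last by [].
by rewrite -hnorm_cpoint expr_lt1// sqrtr_ge0.
Qed.

Lemma weightE p : w p = (1 - tuple_sqnorm p) ^+ alpha.
Proof. by rewrite /bergman_weight hnorm_cpoint. Qed.

Lemma weight_ge0 p : ball p -> 0 <= w p.
Proof. by move=> /unit_ballP/ltW p1; rewrite weightE exprn_ge0// subr_ge0. Qed.

Lemma weight_le1 p : ball p -> w p <= 1.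
Proof.
move=> /unit_ballP/ltW p1; rewrite weightE exprn_ile1 ?subr_ge0//.
by rewrite gerBl tuple_sqnorm_ge0.
Qed.

Lemma measurable_ball : measurable ball.
Proof.
rewrite (_ : ball = @tuple_sqnorm R d @^-1` `]-oo, 1[%classic).
  by apply: measurable_preimageT => //; exact: measurable_tuple_sqnorm.
by apply/funext => p; apply/propext; rewrite unit_ballP /= in_itv.
Qed.

Lemma measurable_weight D : measurable_fun D (fun p => w p).
Proof.
apply: measurable_funTS.
rewrite (_ : (fun _ => _) = fun p => (1 - tuple_sqnorm p) ^+ alpha).
  apply: measurable_funX; apply: measurable_funB => //.
  exact: measurable_tuple_sqnorm.
by apply/funext => p; rewrite weightE.
Qed.

(** On the unit ball the truncated power of the Dirichlet integral is the
    Bergman weight. *)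
Lemma ball_moment (m : mnat d) :
  \int[mu]_(p in ball) ((\prod_i sqnorm (tnth p i) ^+ m i) * w p) =
  kappa ^+ d * (mfactorial m)%:R * alpha`!%:R / (alpha + d + mdegree m)`!%:R.
Proof.
rewrite /Rintegral integral_mkcond.
have := @dirichlet_integral R d m alpha 1.
rewrite /truncpow ltr01 expr1n mulr1 -/(mfactorial m) -/(mdegree m) => H.
transitivity (fine (\int[mu]_p (dirichlet_integrand m alpha 1 p)%:E)%E).
  congr fine; apply: eq_integral => p _; rewrite patchE /dirichlet_integrand.
  rewrite /truncpow subr_gt0; case: ifPn => pb.
    by rewrite inE unit_ballP in pb; rewrite pb weightE.
  case: ltP => // p1; last by rewrite mulr0.
  by move/negP: pb; rewrite inE unit_ballP.
by rewrite H.
Qed.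

Lemma ball_lty : (mu ball < +oo)%E.
Proof.
rewrite -(setIT ball) -integral_indic//; last exact: measurable_ball.
have := @dirichlet_integral R d (fun=> 0%N) 0 1.
set c := (_ * _) => H.
rewrite (_ : integral _ _ _ = c%:E) ?ltry// -H.
apply: eq_integral => p _; congr EFin; rewrite indicE /dirichlet_integrand.
rewrite big1// mul1r /truncpow subr_gt0 expr0.
case: ltP => p1; first by rewrite mem_set//; apply/unit_ballP.
by rewrite memNset// => /unit_ballP; rewrite ltNge p1.
Qed.

Definition bounded_measurable g :=
  measurable_fun ball g /\ exists M, forall p, ball p -> `|g p| <= M.

Lemma bounded_measurable_cst (c : R) : bounded_measurable (fun=> c).
Proof. by split => //; exists `|c|. Qed.

Lemma bounded_measurableD g h : bounded_measurable g -> bounded_measurable h ->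
  bounded_measurable (fun p => g p + h p).
Proof.
move=> [mg [M gM]] [mh [N hN]]; split; first exact: measurable_funD.
by exists (M + N) => p bp; rewrite (le_trans (ler_normD _ _))// lerD ?gM ?hN.
Qed.

Lemma bounded_measurableM g h : bounded_measurable g -> bounded_measurable h ->
  bounded_measurable (fun p => g p * h p).
Proof.
move=> [mg [M gM]] [mh [N hN]]; split; first exact: measurable_funM.
by exists (M * N) => p bp; rewrite normrM ler_pM ?gM ?hN.
Qed.

Lemma bounded_measurable_weight : bounded_measurable (fun p => w p).
Proof.
split; first exact: measurable_weight.
by exists 1 => p bp; rewrite ger0_norm ?weight_le1 ?weight_ge0.
Qed.

Lemma bounded_measurable_integrable g : bounded_measurable g ->
  mu.-integrable ball (EFin \o g).
Proof.
move=> [mg [M gM]].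
apply: measurable_bounded_integrable => //.
- exact: measurable_ball.
- exact: ball_lty.
exists M; split; first exact: num_real.
by move=> x Mx p bp /=; apply: le_trans (gM p bp) (ltW Mx).
Qed.

Definition wint g : R := \int[mu]_(p in ball) (g p * w p).

Lemma weighted_integrable g : bounded_measurable g ->
  mu.-integrable ball (EFin \o (fun p => g p * w p)).
Proof.
move=> bg; apply: bounded_measurable_integrable.
exact: bounded_measurableM bg bounded_measurable_weight.
Qed.

Lemma eq_wint g h : (forall p, ball p -> g p = h p) -> wint g = wint h.
Proof. by move=> gh; apply: eq_Rintegral => p; rewrite inE => /gh ->. Qed.

Lemma wintZ (c : R) g : bounded_measurable g ->
  wint (fun p => c * g p) = c * wint g.
Proof.
move=> bg; rewrite /wint -RintegralZl; first last.
- exact: weighted_integrable.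
- exact: measurable_ball.
by apply: eq_Rintegral => p _; rewrite mulrA.
Qed.

Lemma wintD g h : bounded_measurable g -> bounded_measurable h ->
  wint (fun p => g p + h p) = wint g + wint h.
Proof.
move=> bg bh; rewrite /wint -RintegralD; first last.
- exact: weighted_integrable.
- exact: weighted_integrable.
- exact: measurable_ball.
by apply: eq_Rintegral => p _; rewrite mulrDl.
Qed.

Lemma le_norm_wint g M : bounded_measurable g ->
  (forall p, ball p -> `|g p| <= M) -> `|wint g| <= M * wint (fun=> 1).
Proof.
move=> bg gM; have [mg _] := bg.
have bn : bounded_measurable (fun p => `|g p|).
  by split; [exact: measurableT_comp | exists M => p bp; rewrite normr_id gM].
rewrite -wintZ; last exact: bounded_measurable_cst.
apply: le_trans (le_normr_Rintegral measurable_ball (weighted_integrable bg)) _.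
apply: le_Rintegral.
- exact: measurable_ball.
- apply: bounded_measurable_integrable; split.
    apply: measurableT_comp => //.
    exact: (bounded_measurableM bg bounded_measurable_weight).1.
  have [_ [N gN]] := bounded_measurableM bg bounded_measurable_weight.
  by exists N => p bp; rewrite normr_id gN.
- by apply: weighted_integrable; exact: bounded_measurable_cst.
move=> p bp; rewrite normrM (ger0_norm (weight_ge0 bp)) mulr1.
by rewrite ler_wpM2r ?weight_ge0// gM.
Qed.

Definition rotate_coord (j : 'I_d) (p : T) : T :=
  [tuple (if val i == val j then rotation else id) (tnth p i) | i < d].

Lemma rotate_coord_preserves j : scales_measure mu nng1 (rotate_coord j).
Proof.
apply: (@scales_tuple_measure R _ _ (@lebesgue_plane R) d
  (fun i => if i == val j then rotation else id)) => i.
case: ifP => _; first exact: rotation_preserves_plane.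
by split=> [|A mA]; rewrite ?mul1e.
Qed.

Lemma sqnorm_rotation (z : planeR R) : sqnorm (rotation z) = sqnorm z.
Proof. by case: z => x y; rewrite /sqnorm/=; field. Qed.

Lemma tuple_sqnorm_rotate j p : tuple_sqnorm (rotate_coord j p) = tuple_sqnorm p.
Proof.
apply: eq_bigr => i _; rewrite tnth_mktuple.
by case: ifP => _; rewrite ?sqnorm_rotation.
Qed.

(** Rotating one coordinate preserves the volume, the ball and the weight. *)
Lemma wint_rotate j g : bounded_measurable g ->
  wint (fun p => g (rotate_coord j p)) = wint g.
Proof.
move=> bg; rewrite /wint [LHS]Rintegral_mkcond [RHS]Rintegral_mkcond /Rintegral.
have [mg _] := bounded_measurableM bg bounded_measurable_weight.
rewrite -[in RHS](scales_measure_integral (rotate_coord_preserves j)); last first.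
  apply/measurable_EFinP.
  by apply: (measurable_restrict _ measurable_ball measurableT).1; rewrite setTI.
congr fine; apply: eq_integral => p _; rewrite !patchE.
have -> : (rotate_coord j p \in ball) = (p \in ball).
  by apply/idP/idP; rewrite !inE !unit_ballP tuple_sqnorm_rotate.
by rewrite !weightE tuple_sqnorm_rotate.
Qed.

End weighted_ball.

(** * Orthogonality of monomials and coefficient extraction *)

Section complex_ball_integral.
Context {R : realType} {d : nat} (alpha : nat).
Local Notation T := (d.-tuple (planeR R)).
Local Notation ball := (@unit_ball R d).
Local Notation kappa := (@beta_const R 0 0).
Implicit Types (p : T) (f g : T -> R[i]) (c : R[i]) (m n : mnat d).

Definition cbounded_measurable f :=
  bounded_measurable (fun p => Re (f p)) /\ bounded_measurable (fun p => Im (f p)).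

Definition cint f : R[i] :=
  wint alpha (fun p => Re (f p)) +i* wint alpha (fun p => Im (f p)).

Lemma cbounded_measurable_cst c : cbounded_measurable (fun=> c).
Proof. by split; exact: bounded_measurable_cst. Qed.

Lemma bounded_measurableB (g h : T -> R) :
  bounded_measurable g -> bounded_measurable h ->
  bounded_measurable (fun p => g p - h p).
Proof.
move=> bg bh.
have := bounded_measurableD bg
  (bounded_measurableM (bounded_measurable_cst (-1)) bh).
by congr bounded_measurable; apply/funext => p; rewrite mulN1r.
Qed.

Lemma cbounded_measurableD f g : cbounded_measurable f ->
  cbounded_measurable g -> cbounded_measurable (fun p => f p + g p).
Proof.
move=> [f1 f2] [g1 g2]; split.
  have := bounded_measurableD f1 g1.
  by congr bounded_measurable; apply/funext => p; rewrite Re_add.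
have := bounded_measurableD f2 g2.
by congr bounded_measurable; apply/funext => p; rewrite Im_add.
Qed.

Lemma cbounded_measurableM f g : cbounded_measurable f ->
  cbounded_measurable g -> cbounded_measurable (fun p => f p * g p).
Proof.
move=> [f1 f2] [g1 g2]; split.
  have := bounded_measurableB (bounded_measurableM f1 g1)
    (bounded_measurableM f2 g2).
  by congr bounded_measurable; apply/funext => p; rewrite Re_mul.
have := bounded_measurableD (bounded_measurableM f1 g2)
  (bounded_measurableM f2 g1).
by congr bounded_measurable; apply/funext => p; rewrite Im_mul.
Qed.

Lemma cbounded_measurable_conj f : cbounded_measurable f ->
  cbounded_measurable (fun p => Num.conj (f p)).
Proof.
move=> [f1 f2]; split.
  by move: f1; congr bounded_measurable; apply/funext => p; case: (f p).
have := bounded_measurableB (bounded_measurable_cst 0) f2.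
congr bounded_measurable; apply/funext => p; rewrite sub0r.
by case: (f p).
Qed.

Lemma cbounded_measurable_prod (I : Type) (r : seq I) (F : I -> T -> R[i]) :
  (forall i, cbounded_measurable (F i)) ->
  cbounded_measurable (fun p => \prod_(i <- r) F i p).
Proof.
move=> bF; elim: r => [|i r IHr].
  have := cbounded_measurable_cst 1.
  by congr cbounded_measurable; apply/funext => p; rewrite big_nil.
have := cbounded_measurableM (bF i) IHr.
by congr cbounded_measurable; apply/funext => p; rewrite big_cons.
Qed.

Lemma cbounded_measurable_sum (I : Type) (r : seq I) (F : I -> T -> R[i]) :
  (forall i, cbounded_measurable (F i)) ->
  cbounded_measurable (fun p => \sum_(i <- r) F i p).
Proof.
move=> bF; elim: r => [|i r IHr].
  have := cbounded_measurable_cst 0.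
  by congr cbounded_measurable; apply/funext => p; rewrite big_nil.
have := cbounded_measurableD (bF i) IHr.
by congr cbounded_measurable; apply/funext => p; rewrite big_cons.
Qed.

Lemma normc_cpoint_le1 p i : ball p -> normc (Defs.cpoint p i 0) <= 1.
Proof.
move=> /unit_ballP/ltW p1; rewrite -(expr_le1 (n := 2))// ?normc_ge0//.
rewrite normc_cpoint; apply: le_trans p1.
rewrite /tuple_sqnorm (bigD1 i)//= lerDl.
by apply: sumr_ge0 => j _; exact: sqnorm_ge0.
Qed.

Lemma cbounded_measurable_coord i :
  cbounded_measurable (fun p => Defs.cpoint p i 0).
Proof.
have mt : measurable_fun [set: T] (fun p => tnth p i) by exact: measurable_tnth.
split; split.
- apply: measurable_funTS; rewrite (_ : (fun _ => _) = fun p => (tnth p i).1).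
    by apply: (measurableT_comp (@measurable_plane_fst R)).
  by apply/funext => p; rewrite mxE.
- by exists 1 => p bp; apply: le_trans (Re_le_normc _) (normc_cpoint_le1 _ bp).
- apply: measurable_funTS; rewrite (_ : (fun _ => _) = fun p => (tnth p i).2).
    by apply: (measurableT_comp (@measurable_plane_snd R)).
  by apply/funext => p; rewrite mxE.
- by exists 1 => p bp; apply: le_trans (Im_le_normc _) (normc_cpoint_le1 _ bp).
Qed.

Lemma cbounded_measurable_mpower n :
  cbounded_measurable (fun p => mpower (Defs.cpoint p) n).
Proof.
apply: cbounded_measurable_prod => i.
elim: (n i) => [|k IHk].
  have := cbounded_measurable_cst 1.
  by congr cbounded_measurable; apply/funext => p; rewrite expr0.
have := cbounded_measurableM (cbounded_measurable_coord i) IHk.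
by congr cbounded_measurable; apply/funext => p; rewrite exprS.
Qed.

Lemma eq_cint f g : (forall p, ball p -> f p = g p) -> cint f = cint g.
Proof. by move=> fg; congr Complex; apply: eq_wint => p /fg ->. Qed.

Lemma cintD f g : cbounded_measurable f -> cbounded_measurable g ->
  cint (fun p => f p + g p) = cint f + cint g.
Proof.
move=> [f1 f2] [g1 g2].
have -> : cint f + cint g =
  (wint alpha (fun p => Re (f p)) + wint alpha (fun p => Re (g p))) +i*
  (wint alpha (fun p => Im (f p)) + wint alpha (fun p => Im (g p))) by [].
rewrite -!wintD//.
by congr Complex; apply: eq_wint => p _; rewrite (Re_add, Im_add).
Qed.

Lemma cintZ c f : cbounded_measurable f -> cint (fun p => c * f p) = c * cint f.
Proof.
case: c => a b [f1 f2].
have bZ (x : R) (g : T -> R) : bounded_measurable g ->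
    bounded_measurable (fun p => x * g p).
  by apply: bounded_measurableM; exact: bounded_measurable_cst.
have -> : (a +i* b) * cint f =
  (a * wint alpha (fun p => Re (f p)) + (- b) * wint alpha (fun p => Im (f p))) +i*
  (b * wint alpha (fun p => Re (f p)) + a * wint alpha (fun p => Im (f p))).
  by rewrite /cint; simpc; congr Complex; ring.
rewrite -!wintZ// -!wintD; try exact: bZ.
by congr Complex; apply: eq_wint => p _; case: (f p) => x y /=; ring.
Qed.

Lemma cint_sum (I : Type) (r : seq I) (F : I -> T -> R[i]) :
    (forall i, cbounded_measurable (F i)) ->
  cint (fun p => \sum_(i <- r) F i p) = \sum_(i <- r) cint (F i).
Proof.
move=> bF; elim: r => [|i r IHr].
  rewrite big_nil; transitivity (cint (fun p => 0 * 0)).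
    by apply: eq_cint => p _; rewrite big_nil mul0r.
  by rewrite cintZ ?mul0r//; exact: cbounded_measurable_cst.
rewrite big_cons -IHr -cintD//; last exact: cbounded_measurable_sum.
by apply: eq_cint => p _; rewrite big_cons.
Qed.

Lemma normc_cint_le f (e : R) : cbounded_measurable f ->
  (forall p, ball p -> normc (f p) <= e) ->
  normc (cint f) <= e * (2 * @wint R d alpha (fun=> 1)).
Proof.
move=> [f1 f2] fe; apply: le_trans (normc_le_Re_Im _) _.
have := le_norm_wint alpha f1 (fun p bp => le_trans (Re_le_normc _) (fe p bp)).
have := le_norm_wint alpha f2 (fun p bp => le_trans (Im_le_normc _) (fe p bp)).
by rewrite /=; lra.
Qed.

Lemma cint_rotate j f : cbounded_measurable f ->
  cint (fun p => f (rotate_coord j p)) = cint f.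
Proof.
move=> [f1 f2]; congr Complex.
  exact: (wint_rotate alpha j f1).
exact: (wint_rotate alpha j f2).
Qed.

Definition rotation_factor : R[i] := (3 / 5) +i* (4 / 5).

(** (3 + 4i)^2 = 3 + 4i modulo 5, so every positive power of 3 + 4i is
    congruent to 3 + 4i and cannot equal a power of 5. *)
Lemma rotation_factor_expn k : rotation_factor ^+ k.+1 != 1.
Proof.
suff [x [y E]] : exists x y : int, (5 ^+ k.+1)%:C * rotation_factor ^+ k.+1 =
    ((5 * x + 3)%:~R) +i* ((5 * y + 4)%:~R).
  apply/eqP => rk; move: E; rewrite rk mulr1 => -[_ /esym/eqP].
  by rewrite intr_eq0 => /eqP; lia.
elim: k => [|k [x [y IHk]]].
  exists 0, 0; rewrite !expr1 /rotation_factor; simpc.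
  by congr Complex; field.
(* (3 + 4i) (5x + 3 + (5y + 4) i), with 5 divided out after subtracting 3 + 4i *)
exists (3 * x - 4 * y - 2), (4 * x + 3 * y + 4).
rewrite exprS rmorphM/= [rotation_factor ^+ _]exprS mulrACA IHk /rotation_factor.
by simpc; congr Complex; rewrite !(rmorphD, rmorphM, rmorphN, rmorphB)/=; field.
Qed.

Lemma cpoint_rotation j p i : Defs.cpoint (rotate_coord j p) i 0 =
  (if i == j then rotation_factor else 1) * Defs.cpoint p i 0.
Proof.
rewrite !mxE tnth_mktuple val_eqE; case: eqP => _; last by rewrite mul1r.
have E (x y : R) : (3 / 5 * x - 4 / 5 * y) +i* (4 / 5 * x + 3 / 5 * y) =
    rotation_factor * (x +i* y) by rewrite /rotation_factor; simpc; congr Complex; ring.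
exact: E.
Qed.

Lemma mpower_rotate j p n : mpower (Defs.cpoint (rotate_coord j p)) n =
  rotation_factor ^+ n j * mpower (Defs.cpoint p) n.
Proof.
rewrite /mpower (bigD1 j)//= cpoint_rotation eqxx exprMn -mulrA; congr (_ * _).
rewrite [RHS](bigD1 j)//=; congr (_ * _); apply: eq_bigr => i /negbTE ij.
by rewrite cpoint_rotation ij mul1r.
Qed.

(** The normalizing constant of the measure comes out of the integral. *)
Lemma bergman_innerE (f h : 'cV[R[i]]_d -> R[i]) :
    cbounded_measurable
      (fun p => f (Defs.cpoint p) * Num.conj (h (Defs.cpoint p))) ->
  bergman_inner alpha f h = ((@wint R d alpha (fun=> 1))^-1)%:C *
    cint (fun p => f (Defs.cpoint p) * Num.conj (h (Defs.cpoint p))).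
Proof.
set F := fun p => f _ * _ => -[F1 F2]; rewrite /bergman_inner.
have constE : @bergman_const R d alpha = (@wint R d alpha (fun=> 1))^-1.
  rewrite /bergman_const /wint; congr (_^-1).
  by apply: eq_Rintegral => p _; rewrite mul1r.
have densityE (u : T -> R) : bounded_measurable u ->
    \int[volume R d]_(p in ball) (u p * bergman_density alpha (Defs.cpoint p)) =
    (@wint R d alpha (fun=> 1))^-1 * wint alpha u.
  move=> bu; rewrite -wintZ// -constE /wint; apply: eq_Rintegral => p _.
  by rewrite /bergman_density mulrA [u p * _]mulrC.
have -> : (@wint R d alpha (fun=> 1))^-1%:C * cint F =
   ((@wint R d alpha (fun=> 1))^-1 * wint alpha (fun p => Re (F p))) +i*
   ((@wint R d alpha (fun=> 1))^-1 * wint alpha (fun p => Im (F p))).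
  by rewrite /cint; simpc.
rewrite -!densityE//; congr Complex; apply: eq_Rintegral => p _.
  by rewrite Re_mul/= mulr0 subr0.
by rewrite Im_mul/= mulr0 add0r.
Qed.

Definition mprod_conj n m p : R[i] :=
  mpower (Defs.cpoint p) n * Num.conj (mpower (Defs.cpoint p) m).

Lemma cbounded_measurable_mprod_conj n m : cbounded_measurable (mprod_conj n m).
Proof.
apply: cbounded_measurableM; first exact: cbounded_measurable_mpower.
exact/cbounded_measurable_conj/cbounded_measurable_mpower.
Qed.

Lemma normc_rotation_factor : normc rotation_factor = 1.
Proof.
apply/eqP; rewrite -(eqrXn2 (n := 2)) ?normc_ge0// expr1n sqr_normcE/=.
by apply/eqP; field.
Qed.

Lemma rotation_factor_inj a b :
  rotation_factor ^+ a * Num.conj (rotation_factor ^+ b) = 1 -> a = b.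
Proof.
have u1 k : rotation_factor ^+ k * Num.conj (rotation_factor ^+ k) = 1.
  by rewrite mul_conjc normcX normc_rotation_factor !expr1n.
have u0 k : rotation_factor ^+ k != 0.
  by apply/eqP => uk; move: (u1 k); rewrite uk mul0r => /eqP; rewrite eq_sym oner_eq0.
move=> ab; have {}ab : rotation_factor ^+ a = rotation_factor ^+ b.
  have c0 : Num.conj (rotation_factor ^+ b) != 0 by rewrite conjC_eq0.
  by apply: (mulIf c0); rewrite ab u1.
wlog ltab : a b ab / (a < b)%N.
  by move=> W; case: (ltngtP a b) => [/W->|/W->|].
exfalso; have := rotation_factor_expn (b - a).-1; rewrite prednK ?subn_gt0//.
apply/negP; rewrite negbK; apply/eqP; apply: (mulfI (u0 a)).
by rewrite -exprD mulr1 subnKC ?ab// ltnW.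
Qed.

(** Rotating a coordinate in which n and m differ multiplies the integral by
    a factor different from 1 while leaving it unchanged. *)
Lemma cint_orthogonal n m : n != m -> cint (mprod_conj n m) = 0.
Proof.
move=> nm; have /existsP[j nmj] : [exists j, n j != m j].
  apply: contraNT nm => /existsPn H; apply/eqP/ffunP => j.
  by apply/eqP; move: (H j); rewrite negbK.
set c := rotation_factor ^+ n j * Num.conj (rotation_factor ^+ m j).
have bm := cbounded_measurable_mprod_conj n m.
have : cint (mprod_conj n m) = c * cint (mprod_conj n m).
  rewrite -cintZ// -[LHS](cint_rotate j)//; apply: eq_cint => p _.
  by rewrite /mprod_conj !mpower_rotate rmorphM mulrACA.
move/eqP; rewrite -subr_eq0 -{1}[cint _]mul1r -mulrBl mulf_eq0 => /orP[|/eqP//].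
by rewrite subr_eq0 eq_sym => /eqP/rotation_factor_inj/eqP; rewrite (negbTE nmj).
Qed.

(** The squared norm of z^m for the weight before normalization. *)
Definition monomial_sqnorm m : R :=
  kappa ^+ d * (mfactorial m)%:R * alpha`!%:R / (alpha + d + mdegree m)`!%:R.

Lemma monomial_sqnorm_gt0 m : 0 < monomial_sqnorm m.
Proof.
have f0 k : 0 < k`!%:R :> R by rewrite ltr0n fact_gt0.
rewrite /monomial_sqnorm !mulr_gt0 ?invr_gt0// ?exprn_gt0 ?beta_const00_gt0//.
by rewrite ltr0n prodn_gt0// => i; exact: fact_gt0.
Qed.

Lemma cint_mprod_conj n m :
  cint (mprod_conj n m) = if n == m then (monomial_sqnorm m)%:C else 0.
Proof.
case: eqVneq => [->|]; last exact: cint_orthogonal.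
have mE p : mprod_conj m m p = (\prod_i sqnorm (tnth p i) ^+ m i)%:C.
  rewrite /mprod_conj mul_conjc normc_prod -prodrXl; congr (_%:C).
  by apply: eq_bigr => i _; rewrite normcX exprAC normc_cpoint.
congr Complex.
  rewrite /monomial_sqnorm -(@ball_moment R d alpha m).
  by apply: eq_wint => p _; rewrite mE.
transitivity (wint alpha (fun _ : T => 0 * 0 : R)).
  by apply: eq_wint => p _; rewrite mE mul0r.
by rewrite wintZ ?mul0r//; exact: bounded_measurable_cst.
Qed.

Lemma wint1 : @wint R d alpha (fun=> 1) = monomial_sqnorm [ffun=> 0%N].
Proof.
rewrite /monomial_sqnorm -(@ball_moment R d alpha [ffun=> 0%N]).
by apply: eq_wint => p _; rewrite big1// => i _; rewrite ffunE expr0.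
Qed.

Lemma normc_mpower_le1 p n : ball p -> normc (mpower (Defs.cpoint p) n) <= 1.
Proof.
move=> bp; rewrite normc_prod; apply: prodr_ile1 => i _.
by rewrite normc_ge0 normcX exprn_ile1 ?normc_ge0 ?normc_cpoint_le1.
Qed.

(** A uniform limit is a pointwise limit of the members chosen for the
    tolerances 1 / (k + 1), which yields measurability.  This is how the
    rational functions in the representation are seen to be measurable. *)
Lemma cbounded_measurable_lim f :
  (forall e : R, 0 < e -> exists g, cbounded_measurable g /\
     forall p, ball p -> normc (g p - f p) < e) -> cbounded_measurable f.
Proof.
move=> H.
have real_lim (h : R[i] -> R) : (forall x y, h (x - y) = h x - h y) ->
    (forall x, `|h x| <= normc x) ->
    (forall g, cbounded_measurable g -> bounded_measurable (fun p => h (g p))) ->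
    bounded_measurable (fun p => h (f p)).
  move=> hB hn bh.
  have /choice [g Hg] : forall k : nat, exists g, cbounded_measurable g /\
      forall p, ball p -> normc (g p - f p) < k.+1%:R^-1.
    by move=> k; apply: H; rewrite invr_gt0.
  have hg k p : ball p -> `|h (f p) - h (g k p)| < k.+1%:R^-1.
    by move=> bp; rewrite distrC -hB; apply: le_lt_trans (hn _) ((Hg k).2 p bp).
  split.
    apply: (@measurable_fun_cvg _ _ _ ball (fun k p => h (g k p))) => [k|p bp].
      exact: (bh _ (Hg k).1).1.
    apply/cvgrPdist_lt => e e0; near=> k.
    apply: lt_trans (hg k p bp) _.
    by near: k; exact: near_infty_natSinv_lt (PosNum e0).
  have [_ [M gM]] := bh _ (Hg 0%N).1.
  exists (M + 1) => p bp; rewrite -(subrK (h (g 0%N p)) (h (f p))) addrC.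
  apply: le_trans (ler_normD _ _) _; rewrite lerD ?gM//.
  by apply: le_trans (ltW (hg 0%N p bp)) _; rewrite invr1.
split; apply: real_lim.
- exact: Re_sub.
- exact: Re_le_normc.
- by move=> g [].
- exact: Im_sub.
- exact: Im_le_normc.
- by move=> g [].
Unshelve. all: by end_near. Qed.

Lemma cbounded_measurable_power_series (a : mnat d -> R[i]) f :
    uniform_has_sum ball (fun n p => a n * mpower (Defs.cpoint p) n) f ->
  cbounded_measurable f.
Proof.
move=> Hf; apply: cbounded_measurable_lim => e /Hf[A HA].
exists (fun p => \sum_(n <- enum_fset A) a n * mpower (Defs.cpoint p) n).
split; last by move=> p bp; apply: HA.
apply: cbounded_measurable_sum => n; apply: cbounded_measurableM.
  exact: cbounded_measurable_cst.
exact: cbounded_measurable_mpower.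
Qed.

(** For the partial sums this is orthogonality; the error is controlled
    because |z^m| <= 1 on the ball and the weighted volume is finite. *)
Lemma cint_coefficient (a : mnat d -> R[i]) f m :
    uniform_has_sum ball (fun n p => a n * mpower (Defs.cpoint p) n) f ->
  cint (fun p => f p * Num.conj (mpower (Defs.cpoint p) m)) =
  a m * (monomial_sqnorm m)%:C.
Proof.
move=> Hf.
pose P (A : {fset mnat d}) p := \sum_(n <- enum_fset A) a n * mpower (Defs.cpoint p) n.
have bP A : cbounded_measurable (P A).
  apply: cbounded_measurable_sum => n; apply: cbounded_measurableM.
    exact: cbounded_measurable_cst.
  exact: cbounded_measurable_mpower.
have bf := cbounded_measurable_power_series Hf.
have bc : cbounded_measurable (fun p => Num.conj (mpower (Defs.cpoint p) m)).
  exact/cbounded_measurable_conj/cbounded_measurable_mpower.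
set W := 2 * @wint R d alpha (fun=> 1).
have W0 : 0 < W by rewrite mulr_gt0// wint1 monomial_sqnorm_gt0.
apply: normc_small_eq => e e0.
have [A HA] := Hf (e / W) (divr_gt0 e0 W0).
pose B := (m |` A)%fset.
have {}HA p : ball p -> normc (P B p - f p) < e / W.
  by apply: HA; exact: fsubsetUr.
have PE : cint (fun p => P B p * Num.conj (mpower (Defs.cpoint p) m)) =
    a m * (monomial_sqnorm m)%:C.
  transitivity (cint (fun p => \sum_(n <- enum_fset B) (a n * mprod_conj n m p))).
    by apply: eq_cint => p _; rewrite mulr_suml; apply: eq_bigr => n _; rewrite mulrA.
  rewrite cint_sum => [|n]; last first.
    apply: cbounded_measurableM; first exact: cbounded_measurable_cst.
    exact: cbounded_measurable_mprod_conj.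
  rewrite (bigD1_seq m) ?fset_uniq ?fset1U1//= big1 => [|n nm].
    rewrite addr0 cintZ ?cint_mprod_conj ?eqxx//.
    exact: cbounded_measurable_mprod_conj.
  rewrite cintZ ?cint_mprod_conj ?(negbTE nm) ?mulr0//.
  exact: cbounded_measurable_mprod_conj.
rewrite -PE -[e](divfK (lt0r_neq0 W0)).
set F := fun p => _ * _; set G := fun p => _ * _.
have -> : cint F - cint G = cint (fun p => F p + (-1) * G p).
  rewrite cintD ?cintZ ?mulN1r//; do ?apply: cbounded_measurableM => //.
  exact: cbounded_measurable_cst.
apply: normc_cint_le.
  apply: cbounded_measurableD; first exact: cbounded_measurableM.
  apply: cbounded_measurableM; first exact: cbounded_measurable_cst.
  exact: cbounded_measurableM.
move=> p bp; rewrite mulN1r /F /G -mulrBl normcM normc_conj -[leRHS]mulr1.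
rewrite ler_pM ?normc_ge0 ?normc_mpower_le1//.
by rewrite -normcN opprB ltW ?HA.
Qed.

End complex_ball_integral.

(** * Multi-indices and the multinomial theorem *)

Section multi_index_sets.
Context {d : nat}.
Implicit Types (n : mnat d) (j : 'I_d) (B : {fset mnat d}).
Local Open Scope nat_scope.

Definition mincr j n : mnat d := [ffun i => n i + (i == j)].
Definition mdecr j n : mnat d := [ffun i => n i - (i == j)].

Lemma mincrK j : cancel (mincr j) (mdecr j).
Proof. by move=> n; apply/ffunP => i; rewrite !ffunE addnK. Qed.

Lemma mdecrK j n : 0 < n j -> mincr j (mdecr j n) = n.
Proof.
move=> nj; apply/ffunP => i; rewrite !ffunE.
by case: eqVneq => [->|_]; rewrite ?subn0 ?addn0// subnK.
Qed.

Lemma mincr_gt0 j n : 0 < mincr j n j.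
Proof. by rewrite ffunE eqxx addn1. Qed.

Lemma mdegree_mincr j n : mdegree (mincr j n) = (mdegree n).+1.
Proof.
rewrite /mdegree (eq_bigr (fun i => n i + (i == j))); last first.
  by move=> i _; rewrite ffunE.
rewrite big_split/= -addn1; congr addn.
by rewrite (bigD1 j)//= eqxx big1// => i /negbTE ->.
Qed.

Lemma mfactorial_mincr j n :
  mfactorial (mincr j n) = (n j).+1 * mfactorial n.
Proof.
rewrite /mfactorial (bigD1 j)//= [in RHS](bigD1 j)//= ffunE eqxx addn1 factS.
rewrite mulnA; congr muln; apply: eq_bigr => i /negbTE ij.
by rewrite ffunE ij addn0.
Qed.

Lemma mpower_mincr (C : comNzRingType) (x : 'cV[C]_d) j n :
  (mpower x (mincr j n) = x j ord0 * mpower x n)%R.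
Proof.
rewrite /mpower (bigD1 j)//= [in RHS](bigD1 j)//= ffunE eqxx addn1 exprS.
rewrite mulrA; congr (_ * _)%R; apply: eq_bigr => i /negbTE ij.
by rewrite ffunE ij addn0.
Qed.

Lemma mfactorial_gt0 n : 0 < mfactorial n.
Proof. by apply: prodn_gt0 => i; exact: fact_gt0. Qed.

(** Indices of degree at most K have entries at most K, which makes the set
    finite.  The lock keeps membership from unfolding to the enumeration. *)
Definition mle_set K : {fset mnat d} :=
  let vals (f : {ffun 'I_d -> 'I_K.+1}) : mnat d := [ffun i => val (f i)] in
  locked [fset n in [fset vals f | f in {ffun 'I_d -> 'I_K.+1}]%fset
    | mdegree n <= K]%fset.

Lemma mem_mle_set K n : (n \in mle_set K) = (mdegree n <= K).
Proof.
rewrite /mle_set -lock !inE/=; case: leqP => nK; rewrite ?andbF ?andbT//.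
have ni i : n i < K.+1.
  by rewrite ltnS; apply: leq_trans nK; rewrite /mdegree (bigD1 i)//= leq_addr.
apply/imfsetP; exists [ffun i => Ordinal (ni i)] => //=.
by apply/ffunP => i; rewrite !ffunE.
Qed.

Definition mdeg_set k : {fset mnat d} :=
  locked [fset n in mle_set k | mdegree n == k]%fset.

Lemma mem_mdeg_set k n : (n \in mdeg_set k) = (mdegree n == k).
Proof.
by rewrite /mdeg_set -lock !inE mem_mle_set/=; case: eqP => [->|]; rewrite ?leqnn// andbF.
Qed.

Lemma sub_mle_set B : exists L, (B `<=` mle_set L)%fset.
Proof.
exists (\max_(n <- enum_fset B) mdegree n); apply/fsubsetP => n nB.
by rewrite mem_mle_set; exact: leq_bigmax_seq.
Qed.

Lemma mle_setS K L : K <= L -> (mle_set K `<=` mle_set L)%fset.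
Proof.
by move=> KL; apply/fsubsetP => n; rewrite !mem_mle_set => /leq_trans; apply.
Qed.

Definition mshift_set j B : {fset mnat d} :=
  [fset mdecr j n | n in [fset n in B | 0 < n j]%fset]%fset.

Lemma mem_mshift_set j B (k : mnat d) : (k \in mshift_set j B) = (mincr j k \in B).
Proof.
apply/imfsetP/idP => /= [[n]|kB].
  by rewrite !inE => /andP[nB nj] ->; rewrite mdecrK.
by exists (mincr j k); rewrite ?mincrK// !inE kB mincr_gt0.
Qed.

Section shifted_sums.
Context {V : nmodType}.
Local Open Scope ring_scope.

(** The coefficients of t_j f when u are those of f. *)
Definition mshift j (u : mnat d -> V) (n : mnat d) : V :=
  if (0 < n j)%N then u (mdecr j n) else 0.

Lemma sum_mshift j B (u : mnat d -> V) :
  \sum_(n <- enum_fset B) mshift j u n = \sum_(k <- enum_fset (mshift_set j B)) u k.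
Proof.
rewrite /mshift_set big_imfset/=; last first.
  move=> m n /=; rewrite !inE => /andP[_ mj] /andP[_ nj] e.
  by rewrite -(mdecrK mj) -(mdecrK nj) e.
by rewrite -big_fset_condE/= [RHS]big_mkcond.
Qed.

Lemma sum_mle_set (u : mnat d -> V) K :
  \sum_(n <- enum_fset (mle_set K)) u n =
  \sum_(k < K.+1) \sum_(n <- enum_fset (mdeg_set k)) u n.
Proof.
elim: K => [|K IHK].
  rewrite big_ord_recr big_ord0/= add0r; apply: eq_fbigl => n.
  by rewrite mem_mle_set mem_mdeg_set leqn0.
rewrite big_ord_recr/= -IHK (big_fsetID _ (fun n => mdegree n <= K)%N)/=.
congr (_ + _); apply: eq_fbigl => n.
  rewrite !inE !mem_mle_set/=; case: (leqP (mdegree n) K) => nK; rewrite ?andbF//.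
  by rewrite andbT leqW.
by rewrite !inE !mem_mle_set mem_mdeg_set/= -ltnNge eqn_leq.
Qed.

End shifted_sums.

Lemma mshift_mdeg_set j k : mshift_set j (mdeg_set k.+1) = mdeg_set k.
Proof.
by apply/fsetP => n; rewrite mem_mshift_set !mem_mdeg_set mdegree_mincr eqSS.
Qed.

End multi_index_sets.

Section multinomial.
Context {F : numFieldType} {d : nat}.
Implicit Types (t : 'cV[F]_d) (n : mnat d).

(** Dividing by n! turns the Euler operator into a shift, see
    [divided_mpower_mincr]. *)
Definition divided_mpower t n : F := mpower t n / (mfactorial n)%:R.

Lemma divided_mpower_mincr t n j :
  (n j)%:R * divided_mpower t n = t j 0 * mshift j (divided_mpower t) n.
Proof.
rewrite /mshift; case: ltnP => nj; last first.
  by move: nj; rewrite leqn0 => /eqP ->; rewrite mul0r mulr0.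
rewrite -{1 2}(mdecrK nj) /divided_mpower mpower_mincr mfactorial_mincr.
rewrite [in X in X%:R * _]ffunE eqxx addn1 natrM.
have cancel (A x y f : F) : A != 0 -> f != 0 -> A * (x * y / (A * f)) = x * (y / f).
  by move=> A0 f0; field; rewrite A0 f0.
by rewrite cancel ?pnatr_eq0// -lt0n mfactorial_gt0.
Qed.

(** The multinomial theorem.  For H_k, the sum of t^n / n! over |n| = k,
    Euler's relation for homogeneous polynomials reads
    k H_k = (sum_j t_j) H_(k-1), and the claim follows by induction on k. *)
Lemma sum_divided_mpower t k :
  k`!%:R * \sum_(n <- enum_fset (mdeg_set k)) divided_mpower t n =
  (\sum_j t j 0) ^+ k.
Proof.
elim: k => [|k IHk].
  rewrite mul1r expr0 (_ : mdeg_set 0 = [fset ([ffun=> 0%N] : mnat d)]%fset).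
    rewrite big_seq_fset1 /divided_mpower /mpower /mfactorial.
    rewrite !big1 ?divr1// => i _; by rewrite ffunE ?fact0 ?expr0.
  apply/fsetP => n; rewrite mem_mdeg_set inE; apply/idP/eqP => [|->].
    rewrite sum_nat_eq0 => /forallP n0; apply/ffunP => i.
    by rewrite ffunE; exact/eqP/n0.
  by rewrite /mdegree big1// => i _; rewrite ffunE.
have euler : k.+1%:R * \sum_(n <- enum_fset (mdeg_set k.+1)) divided_mpower t n =
    (\sum_j t j 0) * \sum_(n <- enum_fset (mdeg_set k)) divided_mpower t n.
  transitivity (\sum_(n <- enum_fset (mdeg_set k.+1))
      \sum_j (n j)%:R * divided_mpower t n).
    rewrite mulr_sumr; apply: eq_big_seq => n.
    by rewrite mem_mdeg_set -mulr_suml -natr_sum => /eqP <-.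
  rewrite exchange_big/= mulr_suml; apply: eq_bigr => j _.
  under eq_bigr do rewrite divided_mpower_mincr.
  by rewrite -mulr_sumr sum_mshift mshift_mdeg_set.
by rewrite factS natrM mulrAC euler -mulrA [_ * k`!%:R]mulrC IHk exprS.
Qed.

End multinomial.

(** * The negative binomial series *)

Section negative_binomial.
Context {R : realType}.
Implicit Types (N K k : nat) (x : R) (y : R[i]).

(** The coefficient of y ^ k in (1 - y) ^ (- N), in a form that also covers
    N = 0. *)
Definition negbin N k : R := pochhammer N%:R k / k`!%:R.

Lemma pochhammerS (C : nzRingType) (b : C) k :
  pochhammer b k.+1 = pochhammer b k * (b + k%:R).
Proof. by rewrite /pochhammer big_ord_recr. Qed.

Lemma pochhammer_nat_gt0 N k : (0 < N)%N -> 0 < pochhammer (N%:R : R) k.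
Proof.
move=> N0; rewrite prodr_gt0// => i _.
by rewrite -natrD ltr0n addn_gt0 N0.
Qed.

Lemma rmorph_pochhammer (A B : nzRingType) (f : {rmorphism A -> B}) (b : A) k :
  f (pochhammer b k) = pochhammer (f b) k.
Proof.
rewrite /pochhammer rmorph_prod; apply: eq_bigr => i _.
by rewrite rmorphD rmorph_nat.
Qed.

Lemma negbin_ge0 N k : 0 <= negbin N k.
Proof. by rewrite divr_ge0// prodr_ge0// => i _; rewrite -natrD. Qed.

Lemma negbin0 N : negbin N 0 = 1.
Proof. by rewrite /negbin /pochhammer big_ord0 divr1. Qed.

Lemma negbin0S k : negbin 0 k.+1 = 0.
Proof.
by rewrite /negbin /pochhammer big_ord_recl addr0 mul0r mul0r.
Qed.

Lemma negbinS N k : k.+1%:R * negbin N k.+1 = (N + k)%:R * negbin N k.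
Proof.
rewrite /negbin pochhammerS factS natrM natrD.
have f0 : k`!%:R != 0 :> R by rewrite pnatr_eq0 -lt0n fact_gt0.
have s0 : k.+1%:R != 0 :> R by rewrite pnatr_eq0.
by move: f0 s0; move: _`!%:R _.+1%:R => A B A0 B0; field; rewrite A0 B0.
Qed.

Lemma negbinSl N k : N%:R * negbin N.+1 k = (N + k)%:R * negbin N k.
Proof.
rewrite /negbin !mulrA; congr (_ / _); elim: k => [|k IHk].
  by rewrite /pochhammer !big_ord0 addn0.
by rewrite !pochhammerS mulrA IHk !natrD -!natr1; ring.
Qed.

Lemma negbin_pascal N k : negbin N.+1 k.+1 = negbin N.+1 k + negbin N k.+1.
Proof.
have s0 : k.+1%:R != 0 :> R by rewrite pnatr_eq0.
apply: (mulfI s0); rewrite mulrDr !negbinS -(negbinSl N k) -mulrDl -natrD.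
by congr (_%:R * _); lia.
Qed.

(** Pascal's rule for the coefficients telescopes the product of a partial
    sum with 1 - y, leaving only a boundary term.  It is stated along a ring
    morphism because it is used both for real bounds and for complex sums. *)
Lemma sum_negbinS (F : comNzRingType) (f : {rmorphism R -> F}) N K (y : F) :
  (1 - y) * \sum_(k < K.+1) f (negbin N.+1 k) * y ^+ k =
  \sum_(k < K.+1) f (negbin N k) * y ^+ k - f (negbin N.+1 K) * y ^+ K.+1.
Proof.
elim: K => [|K IHK].
  by rewrite !big_ord_recr !big_ord0/= !negbin0 !rmorph1 !add0r expr0 expr1; ring.
rewrite big_ord_recr/= mulrDr IHK [in RHS]big_ord_recr/= negbin_pascal rmorphD.
by rewrite [y ^+ K.+2]exprS; ring.
Qed.

Lemma sum_negbin_le N K x : 0 <= x -> x < 1 ->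
  \sum_(k < K.+1) negbin N k * x ^+ k <= (1 - x) ^- N.
Proof.
move=> x0 x1; have y0 : 0 < 1 - x by rewrite subr_gt0.
elim: N => [|N IHN].
  rewrite big_ord_recl big1/= => [|i _]; last by rewrite negbin0S mul0r.
  by rewrite negbin0 !expr0 invr1 mul1r addr0.
rewrite -(ler_pM2l y0) (@sum_negbinS _ idfun)/=.
rewrite [(1 - x) ^+ N.+1]exprS invfM mulrA divff ?gt_eqF// mul1r; apply: le_trans IHN.
by rewrite gerBl mulr_ge0 ?negbin_ge0// exprn_ge0.
Qed.

(** The coefficients grow slower than any geometric sequence of ratio above
    1: compare with a point y strictly between x and 1, where the partial sums
    are bounded. *)
Lemma negbin_geom_small N x (e : R) : 0 <= x -> x < 1 -> 0 < e ->
  exists K0, forall K, (K0 <= K)%N -> negbin N K * x ^+ K < e.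
Proof.
move=> x0 x1 e0; pose y := (1 + x) / 2.
have y0 : 0 < y by rewrite /y; lra.
have y1 : y < 1 by rewrite /y; lra.
have xy : x < y by rewrite /y; lra.
have M0 : 0 < (1 - y) ^- N by rewrite invr_gt0 exprn_gt0// subr_gt0.
have r0 : 0 <= x / y by rewrite divr_ge0// ltW.
have r1 : `|x / y| < 1 by rewrite ger0_norm// ltr_pdivrMr// mul1r.
have [K0 _ HK] : \forall K \near \oo, (x / y) ^+ K < e / (1 - y) ^- N.
  have /cvgrPdist_lt /(_ _ (divr_gt0 e0 M0)) := cvg_expr r1.
  apply: filterS => K; rewrite sub0r normrN; apply: le_lt_trans.
  exact: ler_norm.
exists K0 => K /HK xK.
have nK : negbin N K * y ^+ K <= (1 - y) ^- N.
  apply: le_trans (sum_negbin_le N K (ltW y0) y1).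
  rewrite big_ord_recr/= lerDr sumr_ge0// => i _.
  by rewrite mulr_ge0 ?negbin_ge0// exprn_ge0// ltW.
have -> : negbin N K * x ^+ K = negbin N K * y ^+ K * (x / y) ^+ K.
  by rewrite -mulrA -exprMn mulrCA divff ?mulr1// gt_eqF.
apply: le_lt_trans (ler_wpM2r _ nK) _.
  by rewrite exprn_ge0.
by rewrite mulrC -ltr_pdivlMr.
Qed.

Definition negbin_sum N K y : R[i] := \sum_(k < K.+1) (negbin N k)%:C * y ^+ k.

(** Induction on N: dividing [sum_negbinS] by 1 - y, whose modulus is at
    least 1 - x, turns convergence for N into convergence for N + 1, the
    boundary term being negligible by [negbin_geom_small]. *)
Lemma negbin_series N x (e : R) : 0 <= x -> x < 1 -> 0 < e ->
  exists K0, forall K, (K0 <= K)%N -> forall y, normc y <= x ->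
  normc (negbin_sum N K y - (1 - y) ^- N) < e.
Proof.
move=> x0 x1; have z0 : 0 < 1 - x by rewrite subr_gt0.
have ny y : normc y <= x -> 1 - x <= normc (1 - y).
  move=> yx; have := le_normcD (1 - y) y; rewrite subrK normc1; lra.
elim: N e => [|N IHN] e e0.
  exists 0%N => K _ y _; rewrite /negbin_sum big_ord_recl big1 => [|i _].
    by rewrite negbin0 rmorph1 !expr0 invr1 mul1r addr0 subrr normc0.
  by rewrite lift0 negbin0S rmorph0 mul0r.
have d0 : 0 < (1 - x) * e / 2 by rewrite !divr_gt0 ?mulr_gt0.
have [K1 H1] := IHN _ d0.
have [K2 H2] := negbin_geom_small N.+1 x0 x1 d0.
exists (maxn K1 K2) => K; rewrite geq_max => /andP[K1K K2K] y yx.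
have nz := lt_le_trans z0 (ny y yx).
have y1 : 1 - y != 0 by apply: contraTN nz => /eqP ->; rewrite normc0 ltxx.
rewrite -(ltr_pM2l nz) -normcM mulrBr /negbin_sum (@sum_negbinS _ (real_complex R)).
rewrite [(1 - y) ^+ N.+1]exprS invfM mulrA divff// mul1r addrAC.
apply: le_lt_trans (le_normcD _ _) _; rewrite normcN normcM normcX normc_real.
rewrite ger0_norm ?negbin_ge0//.
have := H1 K K1K y yx; rewrite /negbin_sum => h1.
have : negbin N.+1 K * normc y ^+ K.+1 <= negbin N.+1 K * x ^+ K.
  rewrite ler_wpM2l ?negbin_ge0// exprSr.
  have yK : normc y ^+ K <= x ^+ K by rewrite lerXn2r// nnegrE ?normc_ge0.
  have y1' : normc y <= 1 by lra.
  by apply: le_trans yK; rewrite ler_piMr// exprn_ge0// normc_ge0.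
have := H2 K K2K; have := ler_wpM2r (ltW e0) (ny y yx).
lra.
Qed.

End negative_binomial.

(** * Uniform power series expansions *)

Section finite_sums.
Context {I : choiceType}.

Lemma sum_fset_split (V : nmodType) (A B : {fset I}) (f : I -> V) :
  (A `<=` B)%fset -> \sum_(n <- enum_fset B) f n =
  \sum_(n <- enum_fset A) f n + \sum_(n <- enum_fset (B `\` A)%fset) f n.
Proof.
move=> AB; rewrite (big_fsetID _ (mem A)) /=; congr (_ + _); apply: eq_fbigl => n.
  rewrite !inE/=; case: (boolP (n \in A)) => nA; rewrite ?andbF// andbT.
  exact: (fsubsetP AB).
by rewrite !inE/= andbC.
Qed.

Lemma le_sum_fset (R : numDomainType) (A B : {fset I}) (f : I -> R) :
    (A `<=` B)%fset -> (forall n, 0 <= f n) ->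
  \sum_(n <- enum_fset A) f n <= \sum_(n <- enum_fset B) f n.
Proof. by move=> AB f0; rewrite (sum_fset_split f AB) lerDl sumr_ge0. Qed.

End finite_sums.

Section uniform_sum_theory.
Context {R : realType} {I : choiceType} {T : Type} (S : set T).
Implicit Types (u v : I -> T -> R[i]) (F G : T -> R[i]).

Lemma eq_uniform_has_sum u v F G :
  (forall n t, S t -> u n t = v n t) -> (forall t, S t -> F t = G t) ->
  uniform_has_sum S u F -> uniform_has_sum S v G.
Proof.
move=> uv FG H e /H[A HA]; exists A => B AB t St.
rewrite -FG// (_ : \sum_(n <- _) v n t = \sum_(n <- enum_fset B) u n t) ?HA//.
by apply: eq_bigr => n _; rewrite uv.
Qed.

Lemma uniform_has_sumD u v F G :
  uniform_has_sum S u F -> uniform_has_sum S v G ->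
  uniform_has_sum S (fun n t => u n t + v n t) (fun t => F t + G t).
Proof.
move=> Hu Hv e e0; have e2 : 0 < e / 2 by rewrite divr_gt0.
have [A HA] := Hu _ e2; have [A' HA'] := Hv _ e2.
exists (A `|` A')%fset => B; rewrite fsubUset => /andP[AB AB'] t St.
rewrite big_split/= opprD addrACA [e]splitr.
by apply: le_lt_trans (le_normcD _ _) _; rewrite ltrD ?HA ?HA'.
Qed.

Lemma uniform_has_sumM (M : R) (g : T -> R[i]) u F :
  (forall t, S t -> normc (g t) <= M) -> uniform_has_sum S u F ->
  uniform_has_sum S (fun n t => g t * u n t) (fun t => g t * F t).
Proof.
move=> gM H e e0; have M0 : 0 < `|M| + 1 by rewrite ltr_wpDl.
have [A HA] := H _ (divr_gt0 e0 M0); exists A => B AB t St.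
rewrite -mulr_sumr -mulrBr normcM.
apply: le_lt_trans (_ : _ <= (`|M| + 1) * _) _; last first.
  by rewrite -(divfK (lt0r_neq0 M0) e) mulrC ltr_pM2r//; exact: (HA B AB t St).
rewrite ler_wpM2r ?normc_ge0//; apply: le_trans (gM t St) _.
by apply: le_trans (ler_norm _) _; rewrite lerDl.
Qed.

Lemma uniform_has_sum_has_sum u F t :
  S t -> uniform_has_sum S u F -> has_sum (u^~ t) (F t).
Proof. by move=> St H e /H[A HA]; exists A => B /HA; apply. Qed.

End uniform_sum_theory.

Section multi_index_sum_theory.
Context {R : realType} {d : nat}.
Implicit Types (t : 'cV[R[i]]_d) (n : mnat d).

Lemma uniform_has_sum_mshift (T : Type) (S : set T) (u : mnat d -> T -> R[i]) F j :
  uniform_has_sum S u F ->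
  uniform_has_sum S (fun n (p : T) => mshift j (u^~ p) n) F.
Proof.
move=> H e /H[A HA].
exists [fset mincr j n | n in A]%fset => B /fsubsetP AB p Sp.
rewrite sum_mshift; apply: HA => //; apply/fsubsetP => n nA.
by rewrite mem_mshift_set; apply/AB/imfsetP; exists n.
Qed.

(** The coefficients are existential because the construction of an expansion
    loses track of them; uniqueness identifies them afterwards. *)
Definition expandable (S : set 'cV[R[i]]_d) (F : 'cV[R[i]]_d -> R[i]) :=
  exists a : mnat d -> R[i], uniform_has_sum S (fun n t => a n * mpower t n) F.

Lemma expandableD S F G :
  expandable S F -> expandable S G -> expandable S (fun t => F t + G t).
Proof.
move=> [a Ha] [b Hb]; exists (fun n => a n + b n).
apply: eq_uniform_has_sum (uniform_has_sumD Ha Hb) => // n t _.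
by rewrite mulrDl.
Qed.

Lemma expandableZ S (c : R[i]) F :
  expandable S F -> expandable S (fun t => c * F t).
Proof.
move=> [a Ha]; exists (fun n => c * a n).
have := @uniform_has_sumM _ _ _ _ (normc c) (fun=> c) _ _ _ Ha.
move=> /(_ (fun _ _ => lexx _)).
by apply: eq_uniform_has_sum => // n t _; rewrite mulrA.
Qed.

Lemma expandable_coord S j F : (forall t, S t -> normc (t j 0) <= 1) ->
  expandable S F -> expandable S (fun t => t j 0 * F t).
Proof.
move=> S1 [a Ha]; exists (mshift j a).
have := uniform_has_sumM S1 (uniform_has_sum_mshift j Ha).
apply: eq_uniform_has_sum => // n t _; rewrite /mshift.
case: ifP => nj; last by rewrite mulr0 mul0r.
by rewrite mulrCA -mpower_mincr mdecrK.
Qed.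

Lemma expandable_linear S (v : 'I_d -> R[i]) F :
    (forall t, S t -> forall j, normc (t j 0) <= 1) ->
  expandable S F -> expandable S (fun t => (1 - \sum_j v j * t j 0) * F t).
Proof.
move=> S1 EF.
suff : forall r : seq 'I_d,
    expandable S (fun t => (1 - \sum_(j <- r) v j * t j 0) * F t).
  by move=> /(_ (index_enum 'I_d)).
elim=> [|j r [a IHr]].
  case: EF => a Ha; exists a.
  by apply: eq_uniform_has_sum Ha => // t _; rewrite big_nil subr0 mul1r.
have [b Hb] : expandable S (fun t => (- v j) * (t j 0 * F t)).
  by apply/expandableZ/expandable_coord => // t /S1.
have [c Hc] : expandable S (fun t =>
    (1 - \sum_(j <- r) v j * t j 0) * F t + (- v j) * (t j 0 * F t)).
  by apply: expandableD; [exists a|exists b].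
exists c; apply: eq_uniform_has_sum Hc => // t _.
by rewrite big_cons; ring.
Qed.

Lemma expandable_prod S (v : 'I_d -> 'I_d -> R[i]) (k : 'I_d -> nat) F :
    (forall t, S t -> forall j, normc (t j 0) <= 1) ->
  expandable S F ->
  expandable S (fun t => F t * \prod_i (1 - \sum_j v i j * t j 0) ^+ k i).
Proof.
move=> S1 EF.
suff : forall r : seq 'I_d, expandable S (fun t =>
    F t * \prod_(i <- r) (1 - \sum_j v i j * t j 0) ^+ k i).
  by move=> /(_ (index_enum 'I_d)).
elim=> [|i r IHr].
  case: EF => a Ha; exists a.
  by apply: eq_uniform_has_sum Ha => // t _; rewrite big_nil mulr1.
have H K : expandable S (fun t => (1 - \sum_j v i j * t j 0) ^+ K *
    (F t * \prod_(i <- r) (1 - \sum_j v i j * t j 0) ^+ k i)).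
  elim: K => [|K IHK].
    case: IHr => a Ha; exists a.
    by apply: eq_uniform_has_sum Ha => // t _; rewrite expr0 mul1r.
  have [a Ha] := expandable_linear (v i) S1 IHK; exists a.
  by apply: eq_uniform_has_sum Ha => // t _; rewrite exprS mulrA.
have [a Ha] := H (k i); exists a.
by apply: eq_uniform_has_sum Ha => // t _; rewrite big_cons mulrCA.
Qed.

Definition negbin_term N n t : R[i] :=
  pochhammer N%:R (mdegree n) / (mfactorial n)%:R * mpower t n.

Lemma negbin_termE N n t : negbin_term N n t =
  (negbin N (mdegree n))%:C * ((mdegree n)`!%:R * divided_mpower t n).
Proof.
rewrite /negbin_term /negbin /divided_mpower fmorph_div/= rmorph_nat.
rewrite (rmorph_pochhammer (real_complex R)) rmorph_nat.
have f0 : (mdegree n)`!%:R != 0 :> R[i] by rewrite pnatr_eq0 -lt0n fact_gt0.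
by rewrite mulrA divfK// mulrA mulrAC.
Qed.

Lemma sum_negbin_term N k t :
  \sum_(n <- enum_fset (mdeg_set k)) negbin_term N n t =
  (negbin N k)%:C * (\sum_j t j 0) ^+ k.
Proof.
rewrite -sum_divided_mpower !mulr_sumr; apply: eq_big_seq => n.
by rewrite mem_mdeg_set => /eqP nk; rewrite negbin_termE nk.
Qed.

Definition vnorm t : 'cV[R]_d := \col_j normc (t j 0).

Lemma normc_mpower t n : normc (mpower t n) = mpower (vnorm t) n.
Proof. by rewrite normc_prod; apply: eq_bigr => i _; rewrite normcX mxE. Qed.

Lemma normc_negbin_term N n t : normc (negbin_term N n t) =
  negbin N (mdegree n) * ((mdegree n)`!%:R * divided_mpower (vnorm t) n).
Proof.
have nn k : normc (k%:R : R[i]) = k%:R.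
  by rewrite -(rmorph_nat (real_complex R)) normc_real normr_nat.
rewrite negbin_termE normcM normc_real ger0_norm ?negbin_ge0// normcM nn.
by rewrite normcM normcV nn normc_mpower.
Qed.

Lemma sum_normc_negbin_term N k t :
  \sum_(n <- enum_fset (mdeg_set k)) normc (negbin_term N n t) =
  negbin N k * (\sum_j normc (t j 0)) ^+ k.
Proof.
have -> : \sum_j normc (t j 0) = \sum_j vnorm t j 0.
  by apply: eq_bigr => j _; rewrite mxE.
rewrite -sum_divided_mpower !mulr_sumr; apply: eq_big_seq => n.
by rewrite mem_mdeg_set => /eqP nk; rewrite normc_negbin_term nk.
Qed.

(** Split a finite sum containing all indices of degree at most K into that
    full part, which is a one-variable partial sum by the multinomial theorem,
    and a remainder.  The remainder is dominated by a difference of two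
    one-variable partial sums at the real point sum_j |t_j|, which is small
    uniformly because that point is at most x. *)
Lemma uniform_has_sum_negbin N (x : R) : 0 <= x -> x < 1 ->
  uniform_has_sum [set t : 'cV[R[i]]_d | \sum_j normc (t j 0) <= x] (negbin_term N)
    (fun t => (1 - \sum_j t j 0) ^- N).
Proof.
move=> x0 x1 e e0; have e3 : 0 < e / 3 by rewrite divr_gt0.
have [K HK] := negbin_series N x0 x1 e3.
exists (mle_set K) => B KB t tx; have [L BL] := sub_mle_set B.
pose L' := maxn K L.
have BL' : (B `<=` mle_set L')%fset.
  by apply: fsubset_trans BL _; apply: mle_setS; exact: leq_maxr.
have sum_le : normc (\sum_j t j 0) <= x by apply: le_trans (le_normc_sum _ _) tx.
rewrite (sum_fset_split _ KB) addrAC.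
apply: le_lt_trans (le_normcD _ _) _.
have h1 := HK K (leqnn K) _ sum_le.
have sumK M : \sum_(n <- enum_fset (mle_set M)) negbin_term N n t =
    negbin_sum N M (\sum_j t j 0).
  by rewrite sum_mle_set; apply: eq_bigr => k _; rewrite sum_negbin_term.
rewrite -sumK in h1.
set r : R := \sum_j normc (t j 0) in tx *.
have r0 : 0 <= r by apply: sumr_ge0 => j _; exact: normc_ge0.
have rx : normc r%:C <= x by rewrite normc_real ger0_norm.
have sumr M : negbin_sum N M r%:C =
    (\sum_(n <- enum_fset (mle_set M)) normc (negbin_term N n t))%:C.
  rewrite sum_mle_set /negbin_sum [RHS]rmorph_sum; apply: eq_bigr => k _.
  by rewrite sum_normc_negbin_term -rmorphXn -rmorphM.
have h2 := HK K (leqnn K) _ rx.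
have h3 := HK L' (leq_maxl K L) _ rx.
have tail : normc (\sum_(n <- enum_fset (B `\` mle_set K)%fset) negbin_term N n t)
    <= `|\sum_(n <- enum_fset (mle_set L')) normc (negbin_term N n t) -
       \sum_(n <- enum_fset (mle_set K)) normc (negbin_term N n t)|.
  apply: le_trans (le_normc_sum _ _) _.
  rewrite [X in `|X - _|](sum_fset_split _ (mle_setS (leq_maxl K L))).
  rewrite addrC addKr ger0_norm ?sumr_ge0// => [|n _]; last exact: normc_ge0.
  by apply: le_sum_fset => [|n]; [exact: fsetSD | exact: normc_ge0].
have : normc (negbin_sum N L' r%:C - negbin_sum N K r%:C) < e / 3 + e / 3.
  rewrite -(subrKA ((1 - r%:C) ^- N)).
  apply: le_lt_trans (le_normcD _ _) _; rewrite ltrD//.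
  by rewrite -normcN opprB.
rewrite !sumr -rmorphB normc_real => h4.
have := le_lt_trans tail h4; move: h1.
set a := normc _; set b := normc _; lra.
Qed.

End multi_index_sum_theory.

(** * Uniqueness of power series coefficients *)

Section absolute_summation.
Context {R : realType}.

(** If all finite sums away from A are small, then so are those of the terms
    with h >= 0 and of the terms with h < 0 taken separately, hence the sum of
    absolute values. *)
Lemma sum_norm_part_le (I : choiceType) (h : {additive R[i] -> R}) (v : I -> R[i])
    (A : {fset I}) (e : R) :
    (forall x, `|h x| <= normc x) ->
    (forall B, fdisjoint A B -> normc (\sum_(n <- enum_fset B) v n) <= e) ->
  forall B, fdisjoint A B -> \sum_(n <- enum_fset B) `|h (v n)| <= e + e.
Proof.
move=> hn vA B AB; rewrite (big_fsetID _ (fun n => 0 <= h (v n)))/=.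
have sub P : fdisjoint A [fset n in B | P n]%fset.
  apply: fdisjointWr AB; apply/fsubsetP => n; by rewrite !inE => /andP[].
have part P : `|\sum_(n <- [fset n in B | P n]%fset) h (v n)| <= e.
  by rewrite -raddf_sum; apply: le_trans (hn _) (vA _ (sub P)).
apply: lerD.
  rewrite (eq_big_seq (fun n => h (v n))) => [|n]; last first.
    by rewrite !inE => /andP[_ /ger0_norm].
  exact: le_trans (ler_norm _) (part _).
rewrite (eq_big_seq (fun n => - h (v n))) => [|n]; last first.
  by rewrite !inE -ltNge => /andP[_ /ltr0_norm].
by rewrite sumrN; apply: le_trans (ler_norm _) _; rewrite normrN.
Qed.

Lemma sum_normc_le (I : choiceType) (v : I -> R[i]) (A : {fset I}) (e : R) :
    (forall B, fdisjoint A B -> normc (\sum_(n <- enum_fset B) v n) <= e) ->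
  forall B, fdisjoint A B -> \sum_(n <- enum_fset B) normc (v n) <= 4 * e.
Proof.
move=> vA B AB.
have h1 := sum_norm_part_le (h := @complex.Re R : {additive _ -> _}) (@Re_le_normc R) vA AB.
have h2 := sum_norm_part_le (h := @complex.Im R : {additive _ -> _}) (@Im_le_normc R) vA AB.
apply: le_trans (_ : _ <= \sum_(n <- enum_fset B) `|Re (v n)| +
                          \sum_(n <- enum_fset B) `|Im (v n)|) _; last by lra.
by rewrite -big_split; apply: ler_sum => n _; exact: normc_le_Re_Im.
Qed.

End absolute_summation.

Section power_series_uniqueness.
Context {R : realType} {d : nat}.
Implicit Types (t : 'cV[R[i]]_d) (a b : mnat d -> R[i]).

(** On the polydisc of radius s every term is dominated by its modulus at
    (s, ..., s), where the series is absolutely summable. *)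
Lemma has_sum_polydisc a (s : R) (S : set 'cV[R[i]]_d) (F : 'cV[R[i]]_d -> R[i]) :
    0 <= s -> S (const_mx s%:C) ->
    (forall t, S t -> forall j, normc (t j 0) <= s) ->
    (forall t, S t -> has_sum (fun n => a n * mpower t n) (F t)) ->
  uniform_has_sum S (fun n t => a n * mpower t n) F.
Proof.
move=> s0 Ss Sle HF e e0; set t0 := const_mx s%:C in Ss *.
(* e / 16 becomes e / 8 for a difference of two sums and e / 2 after passing
   to absolute values, which costs the factor 4 of [sum_normc_le] *)
have e16 : 0 < e / 16 by rewrite divr_gt0.
have e2 : 0 < e / 2 by rewrite divr_gt0.
have [A HA] := HF _ Ss _ e16.
have small B : fdisjoint A B ->
    normc (\sum_(n <- enum_fset B) a n * mpower t0 n) <= e / 8.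
  move=> AB; have := HA (A `|` B)%fset (fsubsetUl _ _).
  have := HA A (fsubset_refl _).
  rewrite (sum_fset_split _ (fsubsetUl A B)) fsetDUl fsetDv fset0U.
  rewrite (fsetDidPl _ _ _); last by rewrite fdisjoint_sym.
  set X := \sum_(n <- A) _; set Y := \sum_(n <- B) _ => h1 h2.
  have -> : Y = (X + Y - F t0) - (X - F t0) by ring.
  apply: le_trans (le_normcD _ _) _; rewrite normcN; move: h1 h2.
  set u := normc _; set v := normc _; lra.
have {}small := sum_normc_le small.
exists A => C AC t St.
have [A' HA'] := HF _ St _ e2.
have := HA' (C `|` A')%fset (fsubsetUr _ _).
rewrite (sum_fset_split _ (fsubsetUl C A')); set D := ((C `|` A') `\` C)%fset.
have AD : fdisjoint A D.
  apply: fdisjointWl AC _; rewrite fdisjoint_sym.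
  by apply/fdisjointP => n; rewrite inE => /andP[].
have : normc (\sum_(n <- enum_fset D) a n * mpower t n) <= e / 2.
  apply: le_trans (le_normc_sum _ _) _.
  apply: le_trans (_ : _ <= 4 * (e / 8)) _; last by lra.
  apply: le_trans (small _ AD); apply: ler_sum => n _.
  rewrite !normcM ler_wpM2l ?normc_ge0// !normc_mpower.
  apply: ler_prod => i _; rewrite !mxE normc_real ger0_norm//.
  by rewrite exprn_ge0 ?normc_ge0//= lerXn2r ?nnegrE ?normc_ge0// Sle.
set X := \sum_(n <- C) _; set Y := \sum_(n <- D) _ => h1 h2.
have -> : X - F t = (X + Y - F t) - Y by ring.
apply: le_lt_trans (le_normcD _ _) _; rewrite normcN; move: h1 h2.
set u := normc _; set v := normc _; lra.
Qed.

Lemma mpowerZ (c : R[i]) t (n : mnat d) :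
  mpower (c *: t) n = c ^+ mdegree n * mpower t n.
Proof.
rewrite /mpower /mdegree -prodrXr -big_split; apply: eq_bigr => i _.
by rewrite mxE exprMn.
Qed.

(** Both families are recovered from F by integrating F(s z) conj(z^m) over the
    unit ball, for s small enough that s z stays in the domain of convergence. *)
Lemma power_series_inj a b (r : R) (F : 'cV[R[i]]_d -> R[i]) : 0 < r ->
    (forall t, hnorm t < r -> has_sum (fun n => a n * mpower t n) (F t)) ->
    (forall t, hnorm t < r -> has_sum (fun n => b n * mpower t n) (F t)) ->
  a =1 b.
Proof.
move=> r0 Ha Hb m.
(* the point (s, ..., s) has norm s sqrt(d), which is less than r *)
have [s [s0 rE]] : exists s, 0 < s /\ r = d.+1%:R * s.
  exists (r / d.+1%:R); split; first by rewrite divr_gt0.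
  by rewrite mulrCA divff ?mulr1// pnatr_eq0.
pose S : set 'cV[R[i]]_d :=
  [set t | hnorm t < r /\ forall j, normc (t j 0) <= s].
have hnorm_lt t : hnorm t ^+ 2 < r ^+ 2 -> hnorm t < r.
  by rewrite ltr_pXn2r ?nnegrE ?sqrtr_ge0// ltW.
have Ss : S (const_mx s%:C).
  split=> [|j]; last by rewrite mxE normc_real ger0_norm// ltW.
  apply: hnorm_lt; rewrite sqr_hnorm.
  under eq_bigr do rewrite mxE normc_real ger0_norm ?(ltW s0)//.
  rewrite sumr_const card_ord rE exprMn -[ltLHS]mulr_natl ltr_pM2r ?exprn_gt0//.
  by rewrite -natrX ltr_nat; lia.
have sub p : unit_ball p -> S (s%:C *: Defs.cpoint p).
  move=> bp; split=> [|j].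
    apply: hnorm_lt; rewrite sqr_hnorm.
    under eq_bigr do rewrite mxE normcM exprMn normc_real ger0_norm ?(ltW s0)//.
    rewrite -mulr_sumr -sqr_hnorm hnorm_cpoint.
    have /unit_ballP p1 := bp.
    apply: (@lt_le_trans _ _ (s ^+ 2)); first by rewrite gtr_pMr ?exprn_gt0.
    rewrite lerXn2r ?nnegrE ?(ltW s0) ?(ltW r0)// rE.
    by rewrite ler_peMl ?(ltW s0)// ler1n.
  rewrite mxE normcM normc_real ger0_norm ?(ltW s0)//.
  by rewrite ler_piMr ?(ltW s0)// normc_cpoint_le1.
have coefE c : (forall t, hnorm t < r -> has_sum (fun n => c n * mpower t n) (F t)) ->
    cint 0 (fun p => F (s%:C *: Defs.cpoint p) * Num.conj (mpower (Defs.cpoint p) m)) =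
    c m * s%:C ^+ mdegree m * (monomial_sqnorm 0 m)%:C.
  move=> Hc.
  have U := has_sum_polydisc (ltW s0) Ss (fun t (h : S t) => h.2) (fun t (h : S t) => Hc t h.1).
  apply: (@cint_coefficient R d 0 (fun n => c n * s%:C ^+ mdegree n)
    (fun p => F (s%:C *: Defs.cpoint p))).
  move=> e /U[A HA]; exists A => B AB p bp.
  have := HA B AB _ (sub p bp).
  by under eq_bigr do rewrite mpowerZ mulrA.
have := coefE a Ha; rewrite (coefE b Hb).
have n0 : (monomial_sqnorm 0 m)%:C != 0 :> R[i].
  by rewrite fmorph_eq0 gt_eqF// monomial_sqnorm_gt0.
move/(mulIf n0); have sm0 : s%:C ^+ mdegree m != 0 :> R[i].
  by rewrite expf_neq0// fmorph_eq0 gt_eqF.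
by move/(mulIf sm0) => ->.
Qed.

End power_series_uniqueness.

(** * Principal powers with integral exponents *)

Section complex_powers.
Context {R : realType}.
Implicit Types (z w : R[i]).

Lemma cexpD z w : cexp (z + w) = cexp z * cexp w.
Proof.
case: z => a b; case: w => c e; rewrite /cexp/= expRD sinD cosD.
by simpc; congr Complex; ring.
Qed.

Lemma cexp0 : cexp (0 : R[i]) = 1.
Proof. by rewrite /cexp/= expR0 cos0 sin0 mulr1 mulr0. Qed.

Lemma cexp_mulrn w n : cexp (n%:R * w) = cexp w ^+ n.
Proof.
elim: n => [|n IHn]; first by rewrite mul0r cexp0 expr0.
by rewrite -natr1 mulrDl mul1r cexpD IHn exprSr.
Qed.

Lemma cexpN w : cexp (- w) = (cexp w)^-1.
Proof.
have ww : cexp w * cexp (- w) = 1 by rewrite -cexpD subrr cexp0.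
have w0 : cexp w != 0.
  by apply/eqP => w0; move: ww; rewrite w0 mul0r => /eqP; rewrite eq_sym oner_eq0.
by apply: (mulfI w0); rewrite ww divff.
Qed.

Lemma clogK z : z != 0 -> cexp (clog z) = z.
Proof.
move=> z0; have nz : 0 < normc z.
  rewrite lt0r normc_ge0 andbT; apply: contraNneq z0 => /eq0_normc ->.
  by [].
rewrite /cexp/= lnK//.
have n2 := sqr_normcE z; have nz0 := lt0r_neq0 nz.
have c1 : -1 <= Re z / normc z <= 1.
  by rewrite -ler_norml normf_div (ger0_norm (ltW nz)) ler_pdivrMr// mul1r Re_le_normc.
have sE : Num.sqrt (1 - (Re z / normc z) ^+ 2) = `|Im z| / normc z.
  rewrite -[RHS]ger0_norm ?divr_ge0 ?normc_ge0// -sqrtr_sqr; congr Num.sqrt.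
  rewrite [RHS]expr_div_n real_normK ?num_real//.
  have -> : Im z ^+ 2 = normc z ^+ 2 - Re z ^+ 2 by rewrite n2 addrC addKr.
  by field.
rewrite /carg; case: z z0 nz n2 nz0 c1 sE => x y /= _ nz n2 nz0 c1 sE.
case: leP => y0.
  rewrite acosK// sin_acos// sE ger0_norm//.
  by congr Complex; rewrite mulrC divfK.
rewrite cosN sinN acosK// sin_acos// sE ltr0_norm//.
by congr Complex; [rewrite mulrC divfK | rewrite mulNr opprK mulrC divfK].
Qed.

Lemma cpow_nat z n : z != 0 -> cpow z n%:R = z ^+ n.
Proof. by move=> z0; rewrite /cpow cexp_mulrn clogK. Qed.

Lemma cpow_natN z n : z != 0 -> cpow z (- n%:R) = z ^- n.
Proof. by move=> z0; rewrite /cpow mulNr cexpN cexp_mulrn clogK. Qed.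

End complex_powers.

(** * The group SU(1,d) and the Meixner generating function *)

Section special_unitary.
Context {R : realType} {d : nat}.

(** The upper left entry of g^* J g = J. *)
Lemma SU1_column_norm (a : R[i]) (b c : 'cV[R[i]]_d) (D : 'M[R[i]]_d) :
  SU1 (block_mx a%:M b^T c D) ->
  normc a ^+ 2 = 1 + \sum_i normc (c i 0) ^+ 2.
Proof.
move=> [_]; rewrite /signature_mx tr_block_mx map_block_mx !mulmx_block.
move/(congr1 ulsubmx); rewrite !block_mxKul mulmx1 !mulmx0 addr0 add0r.
move/matrixP/(_ 0 0); rewrite !mxE !big_ord1 !mxE/= !mulr1n.
rewrite mulrC mul_conjc => H.
have {}H : (normc a ^+ 2)%:C - (\sum_i normc (c i 0) ^+ 2)%:C = 1.
  rewrite -H; congr (_ + _); rewrite rmorph_sum -sumrN; apply: eq_bigr => i _.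
  rewrite mulmxN mulmx1 !mxE mulNr mulrC mul_conjc//.
move: H; rewrite -rmorphB => -[]; lra.
Qed.

End special_unitary.

Section pochhammer_factorial.
Context {R : realType}.

Lemma pochhammer_fact N k :
  pochhammer (N.+1%:R : R) k * N`!%:R = (N + k)`!%:R.
Proof.
elim: k => [|k IHk]; first by rewrite /pochhammer big_ord0 mul1r addn0.
by rewrite pochhammerS mulrAC IHk -natrD -natrM addnS factS mulnC addSn.
Qed.

Lemma monomial_sqnorm_ratio d sigma (m : mnat d) : (d < sigma)%N ->
  (@monomial_sqnorm R d (sigma - d.+1) [ffun=> 0%N])^-1 *
    monomial_sqnorm (sigma - d.+1) m =
  (mfactorial m)%:R / pochhammer sigma%:R (mdegree m).
Proof.
move=> ds; rewrite /monomial_sqnorm.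
have -> : mfactorial ([ffun=> 0%N] : mnat d) = 1%N.
  by rewrite /mfactorial big1// => i _; rewrite ffunE.
have -> : Defs.mdegree ([ffun=> 0%N] : mnat d) = 0%N.
  by rewrite /Defs.mdegree big1// => i _; rewrite ffunE.
have -> : (sigma - d.+1 + d = sigma.-1)%N by lia.
have poch := pochhammer_fact sigma.-1 (mdegree m).
rewrite prednK in poch; last by lia.
rewrite addn0 -poch.
have f0 k : k`!%:R != 0 :> R by rewrite pnatr_eq0 -lt0n fact_gt0.
have k0 : @beta_const R 0 0 ^+ d != 0.
  by rewrite expf_neq0// gt_eqF// beta_const00_gt0.
have p0 : pochhammer (sigma%:R : R) (mdegree m) != 0.
  by rewrite gt_eqF// pochhammer_nat_gt0//; lia.
have := f0 (sigma - d.+1)%N; have := f0 sigma.-1.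
move: (_ `!%:R) (_ `!%:R) k0 p0 => A B; move: (_ ^+ d) (pochhammer _ _) => K P.
by move=> K0 P0 A0 B0; field; rewrite K0 P0 A0 B0.
Qed.

End pochhammer_factorial.

Section meixner_generating_function.
Context {R : realType} {d : nat} (sigma : nat) (U : 'M[R[i]]_d) (n : mnat d).
Implicit Types (t : 'cV[R[i]]_d).

(** The Meixner generating function at the point n for beta = sigma: both
    exponents are integers, so principal powers are replaced by ordinary
    ones. *)
Definition meixner_rational t : R[i] :=
  (1 - \sum_j t j 0) ^- (sigma + mdegree n) *
  \prod_i (1 - \sum_j U i j * t j 0) ^+ n i.

Lemma meixner_rational_expandable (x : R) : 0 <= x -> x < 1 ->
  expandable [set t : 'cV[R[i]]_d | \sum_j normc (t j 0) <= x] meixner_rational.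
Proof.
move=> x0 x1; apply: expandable_prod.
  move=> t /= tx j; apply: le_trans (ltW x1); apply: le_trans tx.
  by rewrite (bigD1 j)//= lerDl sumr_ge0// => i _; exact: normc_ge0.
eexists; exact: uniform_has_sum_negbin.
Qed.

Lemma normc_le_hnorm t j : normc (t j 0) <= hnorm t.
Proof.
rewrite -ler_sqr ?nnegrE ?normc_ge0 ?sqrtr_ge0// sqr_hnorm (bigD1 j)//= lerDl.
by apply: sumr_ge0 => i _; exact: sqr_ge0.
Qed.

Lemma small_normc_sum (v : 'I_d -> R[i]) t (r : R) : hnorm t < r ->
  normc (\sum_j v j * t j 0) <= (\sum_j normc (v j)) * r.
Proof.
move=> tr; apply: le_trans (le_normc_sum _ _) _; rewrite mulr_suml.
apply: ler_sum => j _; rewrite normcM ler_wpM2l ?normc_ge0//.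
exact: le_trans (normc_le_hnorm t j) (ltW tr).
Qed.

Lemma one_sub_neq0 (z : R[i]) : normc z < 1 -> 1 - z != 0.
Proof. by apply: contraTneq => /subr0_eq <-; rewrite normc1 ltxx. Qed.

Lemma meixner_genE t :
    normc (\sum_j t j 0) < 1 -> (forall i, normc (\sum_j U i j * t j 0) < 1) ->
  meixner_gen (mvector n) U sigma%:R t = meixner_rational t.
Proof.
move=> t1 U1; rewrite /meixner_gen /meixner_rational; congr (_ * _).
  have -> : vsum (mvector n) = (mdegree n)%:R :> R[i].
    by rewrite /vsum natr_sum; apply: eq_bigr => i _; rewrite mxE.
  by rewrite -opprD -natrD cpow_natN// one_sub_neq0.
by apply: eq_bigr => i _; rewrite mxE cpow_nat// one_sub_neq0.
Qed.

(** The expansion a yields a family satisfying the definition of the Meixner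
    polynomials, so the chosen family satisfies it as well; by uniqueness of
    power series coefficients the two agree. *)
Lemma meixner_coefficient (x : R) (a : mnat d -> R[i]) m :
    (0 < sigma)%N -> 0 < x -> x < 1 ->
    uniform_has_sum [set t : 'cV[R[i]]_d | \sum_j normc (t j 0) <= x]
      (fun k t => a k * mpower t k) meixner_rational ->
  pochhammer sigma%:R (mdegree m) / (mfactorial m)%:R *
    meixner m (mvector n) U sigma%:R = a m.
Proof.
move=> s0 x0 x1 Ha.
(* u is chosen so that a norm below x / u makes sum_j |t_j| and every
   |sum_j U_ij t_j| at most x < 1; no base of a power then vanishes *)
pose u : R := d%:R + \sum_i \sum_j normc (U i j) + 1.
have U0 i : 0 <= \sum_j normc (U i j) by apply: sumr_ge0 => j _; exact: normc_ge0.
have UU0 : 0 <= \sum_i \sum_j normc (U i j) by apply: sumr_ge0.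
have u0 : 0 < u by rewrite /u; have := ler0n R d; lra.
pose r := x / u; have r0 : 0 < r by rewrite divr_gt0.
have ur : u * r = x by rewrite mulrC divfK// gt_eqF.
have le_u y : y <= u -> y * r <= x by move=> yu; rewrite -ur ler_wpM2r// ltW.
have sumt t : hnorm t < r -> \sum_j normc (t j 0) <= x.
  move=> tr; apply: le_trans (le_u d%:R _); last by rewrite /u; lra.
  rewrite -[X in X%:R]card_ord -sumr_const mulr_suml; apply: ler_sum => j _.
  by rewrite mul1r; apply: le_trans (normc_le_hnorm t j) (ltW tr).
have genE t : hnorm t < r ->
    meixner_gen (mvector n) U sigma%:R t = meixner_rational t.
  move=> tr; apply: meixner_genE => [|i].
    exact: le_lt_trans (le_trans (le_normc_sum _ _) (sumt t tr)) x1.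
  apply: le_lt_trans (small_normc_sum _ tr) _; apply: le_lt_trans x1.
  apply: le_u; rewrite /u [X in _ + X + 1](bigD1 i)//=.
  have : 0 <= \sum_(i0 | i0 != i) \sum_j normc (U i0 j) by apply: sumr_ge0.
  have := ler0n R d; lra.
have Hr t : hnorm t < r -> has_sum (fun k => a k * mpower t k) (meixner_rational t).
  by move=> tr; apply: uniform_has_sum_has_sum Ha; exact: sumt.
have coef0 (k : mnat d) : pochhammer sigma%:R (mdegree k) / (mfactorial k)%:R != 0 :> R[i].
  rewrite mulf_neq0 ?invr_eq0 ?pnatr_eq0 -?lt0n ?mfactorial_gt0//.
  rewrite -(rmorph_nat (real_complex R)) -rmorph_pochhammer fmorph_eq0.
  by rewrite gt_eqF// pochhammer_nat_gt0.
pose M0 k := a k / (pochhammer sigma%:R (mdegree k) / (mfactorial k)%:R).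
have M0E : meixner_expansion (mvector n) U sigma%:R M0.
  exists r; split=> // t tr; rewrite genE//.
  move=> e /(Hr t tr)[A HA]; exists A => B AB.
  rewrite (eq_bigr (fun k => a k * mpower t k)) => [|k _]; first exact: HA.
  by rewrite /M0 [_ * (a k / _)]mulrC divfK.
have [r' [r'0 H']] := xgetPex (fun=> 0) (ex_intro _ M0 M0E).
apply: (@power_series_inj _ _
  (fun k => pochhammer sigma%:R (mdegree k) / (mfactorial k)%:R *
    meixner k (mvector n) U sigma%:R) a (Num.min r r') meixner_rational).
- by rewrite lt_min r0 r'0.
- by move=> t; rewrite lt_min => /andP[tr tr']; rewrite -genE//; exact: H'.
- by move=> t; rewrite lt_min => /andP[tr tr']; exact: Hr.
Qed.

End meixner_generating_function.

(** * Matrix coefficients of the Bergman representation *)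

Section bergman_representation.
Context {R : realType} {d : nat} (sigma : nat).
Variables (a : R[i]) (b c : 'cV[R[i]]_d) (D : 'M[R[i]]_d) (n : mnat d).
Hypotheses (a0 : a != 0) (b0 : forall i, b i 0 != 0) (c0 : forall i, c i 0 != 0).
Let U : 'M[R[i]]_d := \matrix_(i, j) (a * D j i / (b i 0 * c j 0)).
Let tau (z : 'cV[R[i]]_d) : 'cV[R[i]]_d := \col_j (- (c j 0 / a) * z j 0).

(** Uses a + c^T z = a (1 - sum_j t_j) and
    b_i + (D^T z)_i = b_i (1 - sum_j U_ij t_j) for t = tau z. *)
Lemma bergman_rep_meixner (z : 'cV[R[i]]_d) :
  bergman_rep sigma (block_mx a%:M b^T c D) (bergman_basis sigma n) z =
  (Num.sqrt (pochhammer sigma%:R (mdegree n) / (mfactorial n)%:R))%:C *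
  a ^- sigma * mpower (\col_i (b i 0 / a)) n * meixner_rational sigma U n (tau z).
Proof.
rewrite /bergman_rep block_mxKul block_mxKur block_mxKdl block_mxKdr trmxK.
rewrite [a%:M 0 0]mxE mulr1n /bergman_basis /meixner_rational.
have qE : a + (c^T *m z) 0 0 = a * (1 - \sum_j tau z j 0).
  rewrite mulrBr mulr1 mulr_sumr !mxE -sumrN; congr (_ + _).
  by apply: eq_bigr => j _; rewrite !mxE; field.
have bE i : (b + D^T *m z) i 0 =
    b i 0 * (1 - \sum_j U i j * tau z j 0).
  rewrite mulrBr mulr1 mulr_sumr !mxE -sumrN; congr (_ + _).
  apply: eq_bigr => j _; rewrite !mxE; field.
  by rewrite a0 b0 c0.
rewrite qE; set q := 1 - \sum_j tau z j 0.
have -> : mpower ((a * q)^-1 *: (b + D^T *m z)) n =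
   mpower (\col_i (b i 0 / a)) n * (q ^- mdegree n *
     \prod_i (1 - \sum_j U i j * tau z j 0) ^+ n i).
  have -> : \col_i (b i 0 / a) = a^-1 *: b.
    by apply/colP => i; rewrite !mxE mulrC.
  rewrite !mpowerZ; have -> : mpower (b + D^T *m z) n =
      mpower b n * \prod_i (1 - \sum_j U i j * tau z j 0) ^+ n i.
    by rewrite /mpower -big_split; apply: eq_bigr => i _; rewrite bE exprMn.
  by rewrite invfM exprMn !exprVn; ring.
by rewrite exprMn exprD !invfM; ring.
Qed.

End bergman_representation.

Theorem theorem3p1 (R : realType) (d sigma : nat)
    (hd : (1 <= d)%N) (hsigma : (d.+1 <= sigma)%N)
    (a : R[i]) (b c : 'cV[R[i]]_d) (D : 'M[R[i]]_d) (g : 'M[R[i]]_(1 + d))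
    (hg : g = block_mx a%:M b^T c D) (hSU : SU1 g)
    (ha : a != 0) (hb : forall i, b i 0 != 0) (hc : forall i, c i 0 != 0)
    (m n : mnat d) :
  let p := \col_i (b i 0 / a) in
  let p' := \col_i (c i 0 / a) in
  let U := \matrix_(i, j) (a * D j i / (b i 0 * c j 0)) in
  matrix_coeff sigma m n g =
    (Num.sqrt (pochhammer sigma%:R (mdegree m) * pochhammer sigma%:R (mdegree n)
               / ((mfactorial m)%:R * (mfactorial n)%:R)))%:C
    * (-1) ^+ mdegree m * a ^- sigma * mpower p' m * mpower p n
    * meixner m (mvector n) U sigma%:R.
Proof.
move=> p p' U; rewrite /matrix_coeff hg.
have s0 : (0 < sigma)%N by apply: leq_trans hsigma.
set tau := fun z : 'cV[R[i]]_d => (\col_j (- (c j 0 / a) * z j 0) : 'cV[R[i]]_d).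
set K : R[i] := (Num.sqrt (pochhammer sigma%:R (mdegree n) / (mfactorial n)%:R))%:C *
  a ^- sigma * mpower p n.
set cm : R := Num.sqrt (pochhammer sigma%:R (mdegree m) / (mfactorial m)%:R).
have repE z : bergman_rep sigma (block_mx a%:M b^T c D) (bergman_basis sigma n) z =
    K * meixner_rational sigma U n (tau z) by exact: bergman_rep_meixner.
pose P2 : R := \sum_j normc (c j 0 / a) ^+ 2.
have na0 : 0 < normc a.
  by rewrite lt0r normc_ge0 andbT; apply: contraNneq ha => /eq0_normc ->.
have P20 : 0 <= P2 by apply: sumr_ge0 => j _; exact: sqr_ge0.
have P21 : P2 < 1.
  have cn : normc a ^+ 2 = 1 + \sum_i normc (c i 0) ^+ 2.
    by apply: (@SU1_column_norm R d a b c D); rewrite -hg.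
  rewrite /P2; under eq_bigr do rewrite normcM normcV exprMn exprVn.
  rewrite -mulr_suml ltr_pdivrMr ?exprn_gt0// mul1r cn; lra.
(* by the arithmetic-geometric mean inequality, |c_j / a| |z_j| is at most
   (|c_j / a|^2 + |z_j|^2) / 2 *)
pose x : R := (P2 + 1) / 2.
have x0 : 0 < x by rewrite /x; lra.
have x1 : x < 1 by rewrite /x; lra.
have [a' Ha'] := meixner_rational_expandable sigma U n (ltW x0) x1.
have coefE := meixner_coefficient m s0 x0 x1 Ha'.
have tau_ball q : unit_ball q -> \sum_j normc (tau (Defs.cpoint q) j 0) <= x.
  move=> /unit_ballP/ltW q1.
  have : \sum_j normc (tau (Defs.cpoint q) j 0) <=
      (P2 + tuple_sqnorm q) / 2.
    rewrite /P2 /tuple_sqnorm -big_split/= mulr_suml; apply: ler_sum => j _.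
    have -> : tau (Defs.cpoint q) j 0 = - (c j 0 / a) * Defs.cpoint q j 0.
      by rewrite [LHS]mxE.
    rewrite normcM normcN -normc_cpoint.
    set u := normc _; set v := normc _.
    by have := sqr_ge0 (u - v); rewrite sqrrB; lra.
  by rewrite /x; lra.
have mpower_tau k z : mpower (tau z) k =
    (-1) ^+ mdegree k * mpower p' k * mpower z k.
  rewrite -mpowerZ /mpower -big_split/=; apply: eq_bigr => i _.
  by rewrite !mxE -exprMn mulN1r.
pose A k := K * a' k * ((-1) ^+ mdegree k * mpower p' k).
have HA : uniform_has_sum (@unit_ball R d) (fun k q => A k * mpower (Defs.cpoint q) k)
    (fun q => bergman_rep sigma (block_mx a%:M b^T c D) (bergman_basis sigma n)
                (Defs.cpoint q)).
  have Hb : uniform_has_sum (@unit_ball R d)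
      (fun k q => a' k * mpower (tau (Defs.cpoint q)) k)
      (fun q => meixner_rational sigma U n (tau (Defs.cpoint q))).
    move=> e /Ha'[A0 HA0]; exists A0 => B AB q bq.
    exact: HA0 AB _ (tau_ball q bq).
  have := uniform_has_sumM (g := fun=> K) (fun _ _ => lexx (normc K)) Hb.
  apply: eq_uniform_has_sum => [k q _|q _]; last by rewrite repE.
  by rewrite /A mpower_tau; ring.
set alpha := (sigma - d.+1)%N.
have basisE q : Num.conj (bergman_basis sigma m (Defs.cpoint q)) =
    cm%:C * Num.conj (mpower (Defs.cpoint q) m).
  by rewrite /bergman_basis rmorphM; congr (_ * _); exact: conjc_real.
have bf := cbounded_measurable_power_series HA.
have bm : cbounded_measurable (fun q => Num.conj (mpower (@Defs.cpoint R d q) m)).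
  exact/cbounded_measurable_conj/cbounded_measurable_mpower.
have bfm := cbounded_measurableM bf bm.
have bi : cbounded_measurable (fun q =>
    bergman_rep sigma (block_mx a%:M b^T c D) (bergman_basis sigma n)
      (Defs.cpoint q) * Num.conj (bergman_basis sigma m (Defs.cpoint q))).
  have := cbounded_measurableM (cbounded_measurable_cst cm%:C) bfm.
  congr cbounded_measurable; apply/funext => q.
  by rewrite basisE mulrCA.
rewrite (bergman_innerE alpha bi).
rewrite (eq_cint alpha (g := fun q => cm%:C *
   (bergman_rep sigma (block_mx a%:M b^T c D) (bergman_basis sigma n)
      (Defs.cpoint q) * Num.conj (mpower (Defs.cpoint q) m)))); last first.
  by move=> q _; rewrite basisE mulrCA.
rewrite cintZ// (cint_coefficient alpha m HA) wint1.
have ratio := @monomial_sqnorm_ratio R d sigma m hsigma.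
have {}ratio : (monomial_sqnorm alpha ([ffun=> 0%N] : mnat d))^-1%:C *
    (monomial_sqnorm alpha m)%:C =
    (mfactorial m)%:R / pochhammer sigma%:R (mdegree m) :> R[i].
  rewrite -rmorphM ratio fmorph_div/= rmorph_nat.
  by rewrite (rmorph_pochhammer (real_complex R)) rmorph_nat.
have -> : Num.sqrt (pochhammer sigma%:R (mdegree m) * pochhammer sigma%:R (mdegree n)
    / ((mfactorial m)%:R * (mfactorial n)%:R)) =
    cm * Num.sqrt (pochhammer sigma%:R (mdegree n) / (mfactorial n)%:R) :> R.
  rewrite -sqrtrM ?divr_ge0 ?(ltW (pochhammer_nat_gt0 _ _))//.
  by congr Num.sqrt; rewrite invfM mulrACA.
rewrite [(cm * _)%:C]rmorphM /A -coefE /K.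
have p0 : pochhammer (sigma%:R : R[i]) (mdegree m) != 0.
  rewrite -(rmorph_nat (real_complex R)) -rmorph_pochhammer fmorph_eq0.
  by rewrite gt_eqF// pochhammer_nat_gt0.
have f0 : (mfactorial m)%:R != 0 :> R[i] by rewrite pnatr_eq0 -lt0n mfactorial_gt0.
have {}ratio : (monomial_sqnorm alpha ([ffun=> 0%N] : mnat d))^-1%:C *
    (monomial_sqnorm alpha m)%:C *
    (pochhammer sigma%:R (mdegree m) / (mfactorial m)%:R) = 1 :> R[i].
  by rewrite ratio mulrA divfK// divff.
have regroup (W N Q c1 c2 s q M e p1 : R[i]) : W * N * Q = 1 ->
    W * (c1 * (c2 * s * q * (Q * M) * (e * p1) * N)) = c1 * c2 * e * s * p1 * q * M.
  by move=> H; rewrite -[RHS]mul1r -H; ring.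
exact: regroup ratio.
Qed.
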